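(* Run the AOAmc sampling procedure (defined in the context) indefinitely. Then it is consistent, i.e., $$\lim_{t\to\infty}\widehat{\mathcal F}^m_{\ell t}=\mathcal F^m_\ell\quad\text{a.s.},\qquad \ell=1,\dots,q .$$
   Context: Model. There are $k$ designs and $q$ contexts $\boldsymbol x_1,\dots,\boldsymbol x_q$, and an integer $m$ with $1\le m<k$. Each design-context pair $(i,\ell)$ has a fixed unknown mean $y_i(\boldsymbol x_\ell)\in\mathbb R$ and a known variance $\sigma_i^2(\boldsymbol x_\ell)>0$. Simulation replications $Y^h_{i\ell}$, $h=1,2,\dots$, are i.i.d. $N(y_i(\boldsymbol x_\ell),\sigma_i^2(\boldsymbol x_\ell))$, and replications of different pairs are independent. In each context the designs are ranked by true mean, $y_{\langle1\rangle_\ell}(\boldsymbol x_\ell)\ge\dots\ge y_{\langle m\rangle_\ell}(\boldsymbol x_\ell)>y_{\langle m+1\rangle_\ell}(\boldsymbol x_\ell)\ge\dots\ge y_{\langle k\rangle_\ell}(\boldsymbol x_\ell)$, so that the top-$m$ set $\mathcal F^m_\ell=\{\langle1\rangle_\ell,\dots,\langle m\rangle_\ell\}$ is unique. Posterior quantities. The conjugate prior of $y_i(\boldsymbol x_\ell)$ is $N(y_i^{(0)}(\boldsymbol x_\ell),(\sigma_i^{(0)}(\boldsymbol x_\ell))^2)$, independent over pairs (the uninformative case $\sigma_i^{(0)}(\boldsymbol x_\ell)=\infty$ is allowed, with $1/\infty=0$). After a total of $t$ replications, with $t_{i\ell}$ of them allocated to $(i,\ell)$ (so $\sum_{i,\ell}t_{i\ell}=t$)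 and with sample mean $\bar Y_{i\ell}=\frac1{t_{i\ell}}\sum_{h=1}^{t_{i\ell}}Y^h_{i\ell}$, the posterior variance and mean are $$(\sigma_i^{(t)}(\boldsymbol x_\ell))^2=\Big(\tfrac1{(\sigma_i^{(0)}(\boldsymbol x_\ell))^2}+\tfrac{t_{i\ell}}{\sigma_i^2(\boldsymbol x_\ell)}\Big)^{-1},\qquad y_i^{(t)}(\boldsymbol x_\ell)=(\sigma_i^{(t)}(\boldsymbol x_\ell))^2\Big(\tfrac{y_i^{(0)}(\boldsymbol x_\ell)}{(\sigma_i^{(0)}(\boldsymbol x_\ell))^2}+\tfrac{t_{i\ell}\bar Y_{i\ell}}{\sigma_i^2(\boldsymbol x_\ell)}\Big).$$ Let $\langle1\rangle_{\ell t},\dots,\langle k\rangle_{\ell t}$ be the designs ranked in decreasing order of posterior mean $y^{(t)}_\cdot(\boldsymbol x_\ell)$ in context $\ell$, and let $\widehat{\mathcal F}^m_{\ell t}=\{\langle1\rangle_{\ell t},\dots,\langle m\rangle_{\ell t}\}$ be the selected set. AOAmc procedure. First $n_0\ge1$ replications are taken from each design-context pair. Afterwards one replication is allocated at a time as follows. For a pair $(h,r)$, let $v^{(h,r)}_{i\ell}$ be the posterior variance of pair $(i,\ell)$ if one additional replication were allocated to $(h,r)$: $v^{(h,r)}_{i\ell}=(\sigma_i^{(t)}(\boldsymbol x_\ell))^2$ if $(i,\ell)\ne(h,r)$, and $v^{(h,r)}_{hr}=\big(1/(\sigma_h^{(0)}(\boldsymbol x_r))^2+(t_{hr}+1)/\sigma_h^2(\boldsymbol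 x_r)\big)^{-1}$. Define $$\widehat V_t(h,r)=\min_{\ell=1,\dots,q}\ \min_{\substack{i=1,\dots,m\\ j=m+1,\dots,k}}\frac{\big(y^{(t)}_{\langle i\rangle_{\ell t}}(\boldsymbol x_\ell)-y^{(t)}_{\langle j\rangle_{\ell t}}(\boldsymbol x_\ell)\big)^2}{v^{(h,r)}_{\langle i\rangle_{\ell t}\,\ell}+v^{(h,r)}_{\langle j\rangle_{\ell t}\,\ell}} .$$ The $(t+1)$-th replication is allocated to a pair $A_{t+1}\in\arg\max_{(h,r)}\widehat V_t(h,r)$, the maximum being over all design-context pairs. *)

(* Defs.v *)
From mathcomp Require Export all_boot all_order all_algebra all_fingroup.
From mathcomp Require Export all_classical all_reals all_analysis.
Set Implicit Arguments.
Unset Strict Implicit.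
Unset Printing Implicit Defensive.
Export Order.TTheory GRing.Theory Num.Theory numFieldNormedType.Exports.
Local Open Scope classical_set_scope.
Local Open Scope ring_scope.

Notation design_context k q := ('I_k * 'I_q)%type.

(** [ranks f s] allows any order among tied values. *)
Definition ranks (R : realType) (k : nat) (f : 'I_k -> R) (s : 'S_k) : Prop :=
  forall i j : 'I_k, (i <= j)%N -> f (s j) <= f (s i).

Definition top (k m : nat) (s : 'S_k) : {set 'I_k} :=
  [set s i | i : 'I_k & (i < m)%N]%SET.

(** Here [a s] is the pair that receives the replication number [s.+1]. *)
Definition count_alloc (k q : nat) (a : nat -> design_context k q) (t : nat)
    (p : design_context k q) : nat :=
  #|[set s : 'I_t | a s == p]%SET|.

Definition sample_mean (R : realType) (y : nat -> R) (n : nat) : R :=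
  n%:R^-1 * \sum_(h < n) y h.

(** The precision [1 / psd ^ 2] of a prior with standard deviation [psd];
    it is [0] for [psd = +oo]. *)
Definition prior_precision (R : realType) (psd : \bar R) : R :=
  fine ((psd ^+ 2)^-1)%E.

Definition post_var (R : realType) (sd : R) (psd : \bar R) (n : nat) : R :=
  (prior_precision psd + n%:R / sd ^+ 2)^-1.

Definition post_mean (R : realType) (sd : R) (pmean : R) (psd : \bar R)
    (y : nat -> R) (n : nat) : R :=
  post_var sd psd n *
  (pmean * prior_precision psd + n%:R * sample_mean y n / sd ^+ 2).

(** The posterior variance of [p] if one more replication went to [hr]. *)
Definition lookahead_var (R : realType) (k q : nat)
    (sd : design_context k q -> R) (psd : design_context k q -> \bar R)
    (n : design_context k q -> nat) (hr p : design_context k q) : R :=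
  post_var (sd p) (psd p) (n p + (p == hr)).

(** [mu], [n] and [rk] are the posterior means, the numbers of replications
    and the rankings of the designs in each context; positions count from 0.
    The values are taken in [\bar R] only so that [+oo] is neutral for the
    minimum. *)
Definition Vhat (R : realType) (k q m : nat)
    (sd : design_context k q -> R) (psd : design_context k q -> \bar R)
    (mu : design_context k q -> R) (n : design_context k q -> nat)
    (rk : 'I_q -> 'S_k) (hr : design_context k q) : \bar R :=
  \big[Order.min/+oo%E]_(l < q)
  \big[Order.min/+oo%E]_(i < k | (i < m)%N)
  \big[Order.min/+oo%E]_(j < k | (m <= j)%N)
    ((mu (rk l i, l) - mu (rk l j, l)) ^+ 2 /
     (lookahead_var sd psd n hr (rk l i, l) +
      lookahead_var sd psd n hr (rk l j, l)))%:E.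

(** One trajectory: [y h p] is the replication number [h.+1] of the pair [p],
    and [rk t l] ranks the designs in the context [l] after [t] replications.
    The order of the initial replications is free, and so are the choices
    among tied posterior means and among the maximizers of [Vhat]. *)
Definition AOAmc_run (R : realType) (k q m n0 : nat)
    (sd : design_context k q -> R)
    (pmean : design_context k q -> R) (psd : design_context k q -> \bar R)
    (y : nat -> design_context k q -> R)
    (a : nat -> design_context k q) (rk : nat -> 'I_q -> 'S_k) : Prop :=
  let n t := count_alloc a t in
  let mu t p := post_mean (sd p) (pmean p) (psd p) (y^~ p) (n t p) in
  (forall p, n (k * q * n0)%N p = n0) /\
  (forall t, (k * q * n0 <= t)%N ->
     (forall l, ranks (fun i => mu t (i, l)) (rk t l)) /\
     (forall hr, (Vhat m sd psd (mu t) (n t) (rk t) hr <=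
                  Vhat m sd psd (mu t) (n t) (rk t) (a t))%E)).

(** Joint independence of the real random variables [X i] and of [U]. *)
Definition independent_with (R : realType) (d d' : measure_display)
    (Omega : measurableType d) (T : measurableType d')
    (P : probability Omega R) (I : eqType)
    (X : I -> {RV P >-> R}) (U : {RV P >-> T}) : Prop :=
  forall (s : seq I) (B : I -> set R) (C : set T),
    uniq s -> (forall i, measurable (B i)) -> measurable C ->
    P ((U @^-1` C) `&` \big[setI/setT]_(i <- s) (X i @^-1` B i)) =
    (P (U @^-1` C) * \prod_(i <- s) P (X i @^-1` B i))%E.

(** The output of the replication number [t.+1]: the first unused replication
    of the pair [A t]. *)
Definition observation (R : realType) (k q : nat) (Omega : Type)
    (Y : nat -> design_context k q -> Omega -> R)
    (A : nat -> Omega -> design_context k q) (t : nat) (w : Omega) : R :=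
  Y (count_alloc (A^~ w) t (A t w)) (A t w) w.

(** The sigma-algebra of the information available after [t] replications:
    the first [t] allocations, their outputs, and an auxiliary variable [U]
    that may be used to randomize. *)
Definition information (R : realType) (k q : nat) (d d' : measure_display)
    (Omega : measurableType d) (T : measurableType d') (U : Omega -> T)
    (Y : nat -> design_context k q -> Omega -> R)
    (A : nat -> Omega -> design_context k q) (t : nat) : set (set Omega) :=
  <<s [set U @^-1` C | C in measurable] `|`
      [set E | exists2 s, (s < t)%N & exists p, E = [set w | A s w = p]] `|`
      [set E | exists2 s, (s < t)%N &
         exists2 B, measurable B & E = observation Y A s @^-1` B] >>.

(** The allocation of each replication is decided without looking at
    outputs that are still to come. *)
Definition nonanticipating (R : realType) (k q : nat) (d d' : measure_display)
    (Omega : measurableType d) (T : measurableType d') (U : Omega -> T)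
    (Y : nat -> design_context k q -> Omega -> R)
    (A : nat -> Omega -> design_context k q) : Prop :=
  forall t p, information U Y A t [set w | A t w = p].

(* Main.v *)
(* Almost surely all the pairs are sampled infinitely often; the strong law of
   large numbers then gives consistency. Suppose that the set F of the pairs
   sampled finitely often is not empty. Almost surely no two posterior means and
   no two terms of the minimum coincide, hence only a pair of the smallest term
   is sampled. The terms with a pair in F stay bounded, so the smallest term
   does too. If p is sampled because of the term of p and a pair f in F, the fact
   that sampling f is not better forces a term without pairs of F to be small as
   well; so, in some context, pairs sampled infinitely often and on both sides of
   the selection have the same true mean. Gaussian fluctuations produce
   arbitrarily large N such that each of these tied pairs, after N replications,
   has its posterior mean far on a prescribed side of the true mean, never far on
   the other side later, and an observation number N + 1 that pulls it back. Let
   p be the last tied pair to reach N replications; all its terms without pairs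
   of F are large, since it is on its side. When p is sampled again,
   it can only be because of a term {p, f} with f in F; this observation makes
   the term smaller, while sampling f would increase it, which contradicts the
   allocation rule at the next step. *)
Require Import Defs.
From HB Require Import structures.
From mathcomp Require Import measurable_realfun.
From mathcomp Require Import zify ring lra.
Set Implicit Arguments.
Unset Strict Implicit.
Unset Printing Implicit Defensive.
Local Open Scope classical_set_scope.
Local Open Scope ring_scope.

(** * Independence *)

(** The obstacle is ties. A frozen posterior mean may shift the selection boundary between designs
    with equal true means; for two such pairs the squared gap and the variances both tend to 0 and
    their term need not converge, so no comparison of limits settles it. Fluctuations do: after
    [N = a ^ 2] replications a gap of order [k / a], whose probability is bounded below in [a],
    stands against variances of order [1 / a ^ 2], so the term is of order [k ^ 2] and exceeds any
    bound once [k] is large. The count [N] is common to all tied pairs, although they reach it at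
    different times; after that a pair only has to avoid the opposite side, at half the distance.
    The sides are those found at some late time of the trajectory; there are finitely many patterns
    of signs, and the almost sure event covers all of them. The last observation works because it
    moves the mean by order [1 / N], whereas the lookahead variance changes only by order
    [1 / N ^ 2]. The probabilistic facts hold for all counts at once; on their common event the
    argument is deterministic. *)

Section Independence.
Context (R : realType) (d : measure_display) (Omega : measurableType d).
Variable P : probability Omega R.

(** In [A], both sides are finite measures, the right one being [P] rescaled by [P B]; they agree on
    a pi-system that contains the whole space, hence on the sigma-algebra it generates. *)
Lemma indep_sigma_left (G : set (set Omega)) (B : set Omega) :
  setI_closed G -> G setT -> G `<=` measurable -> measurable B ->
  (forall A, G A -> P (A `&` B) = (P A * P B)%E) ->
  forall A, <<s G >> A -> P (A `&` B) = (P A * P B)%E.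
Proof.
move=> GI GT Gm mB GB A sA.
have b0 : 0 <= fine (P B) by rewrite fine_ge0.
transitivity (mscale (NngNum b0) P A); last first.
  by rewrite /mscale /= fineK ?fin_num_measure// muleC.
apply: (@g_sigma_algebra_measure_unique _ _ _ G Gm (fun=> setT) (fun=> GT)
   _ (mrestr P mB)) => //.
- by rewrite bigcup_const.
- move=> E GE; rewrite -[LHS]/(P (E `&` B)) GB// muleC.
  by rewrite -[RHS]/((fine (P B))%:E * P E)%E fineK ?fin_num_measure//.
- move=> _; rewrite -[X in (X < _)%E]/(P (setT `&` B)) setTI.
  by rewrite (le_lt_trans (probability_le1 P mB))// ltry.
Qed.

Lemma indep_sigma (G H : set (set Omega)) :
  setI_closed G -> G setT -> G `<=` measurable ->
  setI_closed H -> H setT -> H `<=` measurable ->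
  (forall A B, G A -> H B -> P (A `&` B) = (P A * P B)%E) ->
  forall A B, <<s G >> A -> <<s H >> B -> P (A `&` B) = (P A * P B)%E.
Proof.
move=> GI GT Gm HI HT Hm GH A B sA sB.
have mB : measurable B.
  by move: sB; apply: smallest_sub => //; exact: sigma_algebra_measurable.
apply: (indep_sigma_left GI GT Gm mB _ sA) => A' GA'.
rewrite setIC muleC; apply: (indep_sigma_left HI HT Hm (Gm _ GA') _ sB) => B' HB'.
by rewrite setIC muleC; exact: GH.
Qed.

Context (I : choiceType) (X : I -> {RV P >-> R}).

Definition independent := forall (s : seq I) (B : I -> set R),
  uniq s -> (forall i, measurable (B i)) ->
  P (\big[setI/setT]_(i <- s) (X i @^-1` B i)) =
  (\prod_(i <- s) P (X i @^-1` B i))%E.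

(** Finite lists match the shape of [independent], and finite intersections make this a pi-system,
    as uniqueness of measures requires. *)
Definition cylinder (J : set I) : set (set Omega) :=
  [set E | exists (s : seq I) (B : I -> set R), [/\ uniq s, (forall i, i \in s -> J i),
     (forall i, measurable (B i)) & E = \bigcap_(i in [set` s]) (X i @^-1` B i)]].

Definition sigma_of (J : set I) : set (set Omega) := <<s cylinder J >>.

Lemma cylinderT J : cylinder J setT.
Proof.
by exists [::], (fun=> setT); split=> //; rewrite bigcap_seq big_nil.
Qed.

Lemma cylinder_measurable J : cylinder J `<=` measurable.
Proof.
move=> _ [s [B [_ _ mB ->]]]. rewrite bigcap_seq.
by apply: bigsetI_measurable => i _; rewrite -[X in measurable X]setTI; exact: measurable_funP.
Qed.

Lemma cylinderI J : setI_closed (cylinder J).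
Proof.
move=> _ _ [s [B [us sJ mB ->]]] [s' [B' [us' sJ' mB' ->]]].
exists (undup (s ++ s')), (fun i => (if i \in s then B i else setT) `&`
  (if i \in s' then B' i else setT)); split.
- exact: undup_uniq.
- by move=> i; rewrite mem_undup mem_cat => /orP[/sJ|/sJ'].
- by move=> i; apply: measurableI; case: ifP.
- apply/seteqP; split => w /=.
    move=> [h h'] i /=; rewrite mem_undup mem_cat => _; split; case: ifP => // ?.
    + exact: h.
    + exact: h'.
  move=> h; split=> i /= si.
  + have := h i; rewrite /= mem_undup mem_cat si => /(_ isT) [].
    by [].
  + have := h i; rewrite /= mem_undup mem_cat si orbT => /(_ isT) [].
    by [].
Qed.

Lemma sigma_of_measurable J : sigma_of J `<=` measurable.
Proof.
apply: smallest_sub; last exact: cylinder_measurable.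
exact: sigma_algebra_measurable.
Qed.

Lemma sigma_of_sub (J J' : set I) A : J `<=` J' -> sigma_of J A -> sigma_of J' A.
Proof.
move=> JJ'; rewrite /sigma_of; apply: smallest_sub; first exact: smallest_sigma_algebra.
move=> E [s [C [us sJ mC ->]]]; apply: sub_sigma_algebra.
by exists s, C; split => // i /sJ /JJ'.
Qed.

Lemma indep_sigma_of (J J' : set I) : independent -> J `&` J' = set0 ->
  forall A B, sigma_of J A -> sigma_of J' B -> P (A `&` B) = (P A * P B)%E.
Proof.
move=> iX JJ'; apply: indep_sigma => //.
1,4: exact: cylinderI.
1,3: exact: cylinderT.
1,2: exact: cylinder_measurable.
move=> _ _ [s [B [us sJ mB ->]]] [s' [B' [us' sJ' mB' ->]]].
have dis i : i \in s' -> i \in s = false.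
  move=> is'; apply/negP => si; have : (J `&` J') i by split; [exact: sJ|exact: sJ'].
  by rewrite JJ'.
pose C i := if i \in s then B i else B' i.
have E1 : \bigcap_(i in [set` s]) (X i @^-1` B i) =
          \big[setI/setT]_(i <- s) (X i @^-1` C i).
  rewrite bigcap_seq; apply: eq_big_seq => i si; by rewrite /C si.
have E2 : \bigcap_(i in [set` s']) (X i @^-1` B' i) =
          \big[setI/setT]_(i <- s') (X i @^-1` C i).
  rewrite bigcap_seq; apply: eq_big_seq => i si; by rewrite /C dis.
have mC i : measurable (C i) by rewrite /C; case: ifP.
rewrite E1 E2 -big_cat iX ?iX// ?big_cat// cat_uniq us us' andbT /=.
by apply/hasPn => i /dis ->.
Qed.

Definition sigma_fun d' (T : measurableType d') (J : set I) (f : Omega -> T) :=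
  forall B, measurable B -> sigma_of J (f @^-1` B).

(** Viewing [Omega] with the smaller sigma-algebra gives access to the closure of measurable
    functions under sums, products and maxima. *)
Lemma sigma_funE d' (T : measurableType d') J (f : Omega -> T) : sigma_fun J f <->
  measurable_fun setT (f : g_sigma_algebraType (cylinder J) -> T).
Proof.
split=> h; first by move=> _ B mB; rewrite setTI; exact: h.
by move=> B mB; have := h measurableT B mB; rewrite setTI.
Qed.

Lemma sigma_fun_measurable d' (T : measurableType d') J (f : Omega -> T) : sigma_fun J f -> measurable_fun setT f.
Proof. by move=> h _ B mB; rewrite setTI; exact: (sigma_of_measurable (h _ mB)). Qed.

Lemma sigma_fun_var (J : set I) i : J i -> sigma_fun J (X i).
Proof.
move=> Ji B mB; apply: sub_sigma_algebra; exists [:: i], (fun=> B); split => //.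
- by move=> j; rewrite inE => /eqP ->.
- by rewrite bigcap_seq big_seq1.
Qed.

Lemma sigma_fun_sub d' (T : measurableType d') (J J' : set I) (f : Omega -> T) : J `<=` J' -> sigma_fun J f -> sigma_fun J' f.
Proof.
by move=> JJ' h B /h; exact: sigma_of_sub.
Qed.

(** The joint law of [f] and [g] agrees with the product of their laws on rectangles, hence
    everywhere; Tonelli's theorem then applies. *)
Lemma indep_fubini d1 (T1 : measurableType d1) d2 (T2 : measurableType d2)
    (J J' : set I) (f : Omega -> T1) (g : Omega -> T2) (phi : T1 * T2 -> \bar R) :
  independent -> J `&` J' = set0 -> sigma_fun J f -> sigma_fun J' g ->
  measurable_fun [set: T1 * T2] phi -> (forall z, 0 <= phi z)%E ->
  (\int[P]_w phi (f w, g w) = \int[P]_w \int[P]_w' phi (f w, g w'))%E.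
Proof.
move=> iX JJ' hf hg mphi phi0.
have mf := sigma_fun_measurable hf; have mg := sigma_fun_measurable hg.
pose mfM := isMeasurableFun.Build _ _ _ _ _ mf.
pose f' : {RV P >-> T1} := HB.pack f mfM.
pose mgM := isMeasurableFun.Build _ _ _ _ _ mg.
pose g' : {RV P >-> T2} := HB.pack g mgM.
have mfg : measurable_fun setT (fun w => (f w, g w)).
  exact: measurable_fun_pair.
pose fgM := isMeasurableFun.Build _ _ _ _ _ mfg.
pose fg : {mfun Omega >-> (T1 * T2)%type} := HB.pack (fun w => (f w, g w)) fgM.
transitivity (\int[pushforward P fg]_z phi z)%E.
  by rewrite ge0_integral_pushforward// preimage_setT.
rewrite (eq_measure_integral
  (product_measure1 (distribution P f') (distribution P g'))%E); last first.
  move=> A mA _; apply/esym; apply: product_measure_unique => // B C mB mC.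
  exact: (indep_sigma_of iX JJ' (hf _ mB) (hg _ mC)).
rewrite fubini_tonelli1//; rewrite /fubini_F.
rewrite ge0_integral_distribution//=; last 2 first.
- exact: measurable_fun_fubini_tonelli_F.
- by move=> x; exact: integral_ge0.
apply: eq_integral => w _ /=.
rewrite ge0_integral_distribution//.
by apply/measurableT_comp => //; exact: measurable_pair1.
Qed.

End Independence.

(** * Gaussian sums *)

(** The Radon-Nikodym derivative and [normal_pdf] have the same integral over every measurable set,
    hence coincide almost everywhere. *)
Lemma ge0_integral_normal_prob (R : realType) (m s : R) (f : R -> \bar R) :
  s != 0 -> measurable_fun [set: R] f -> (forall x, 0 <= f x)%E ->
  (\int[normal_prob m s]_x f x =
   \int[lebesgue_measure]_x (f x * (normal_pdf m s x)%:E))%E.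
Proof.
move=> s0 mf f0.
have nm := @normal_prob_dominates R m s.
rewrite -(Radon_Nikodym_SigmaFinite.change_of_variables nm)//.
apply: ae_eq_integral => //.
- apply: emeasurable_funM => //; apply: (measurable_int lebesgue_measure).
  exact: Radon_Nikodym_SigmaFinite.f_integrable.
- apply: emeasurable_funM => //; apply/measurable_EFinP.
  exact: measurable_normal_pdf.
- apply: ae_eqe_mul2l => /=.
  apply: integral_ae_eq => //.
  + exact: Radon_Nikodym_SigmaFinite.f_integrable.
  + apply/measurable_EFinP; exact: measurable_normal_pdf.
  + by move=> E _ mE; rewrite -Radon_Nikodym_SigmaFinite.f_integral.
Qed.

Lemma normal_mgf (R : realType) (m s l : R) : s != 0 ->
  (\int[normal_prob m s]_x (expR (l * ((x - m) / s)))%:E = (expR (l ^+ 2 / 2))%:E)%E.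
Proof.
move=> s0; rewrite ge0_integral_normal_prob//; last first.
  apply/measurable_EFinP; apply: measurableT_comp => //.
  apply: measurable_funM => //; apply: measurable_funM => //.
  exact: measurable_funD.
under eq_integral.
  move=> x _.
  (* Completing the square: tilting a normal density exponentially shifts its mean by [l * s], up to
     a constant factor. *)
  have -> : ((expR (l * ((x - m) / s)))%:E * (normal_pdf m s x)%:E)%E =
    ((expR (l ^+ 2 / 2))%:E * (normal_pdf (m + l * s) s x)%:E)%E.
    rewrite /normal_pdf (negbTE s0) -!EFinM !(mulrCA (expR _)) /normal_fun -!expRD.
    congr (_ * expR _)%:E; rewrite -(mulr_natr (s ^+ 2)).
    by field; rewrite s0.
  over.
rewrite ge0_integralZl//.
- by rewrite integral_normal_pdf mule1.
- by apply/measurable_EFinP; exact: measurable_normal_pdf.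
- by move=> x _; rewrite lee_fin normal_pdf_ge0.
Qed.

Section GaussianSums.
Context (R : realType) (d : measure_display) (Omega : measurableType d).
Variable P : probability Omega R.
Context (I : choiceType) (X : I -> {RV P >-> R}).
Hypothesis indepX : independent X.
Variable Z : I -> Omega -> R.
Hypothesis sigZ : forall i, sigma_fun X [set i] (Z i).
Hypothesis mgfZ : forall i l, (\int[P]_w (expR (l * Z i w))%:E = (expR (l ^+ 2 / 2))%:E)%E.

Lemma sigma_fun_sum (J : set I) (s : seq I) : (forall i, i \in s -> J i) ->
  sigma_fun X J (fun w => \sum_(i <- s) Z i w).
Proof.
move=> sJ; apply/sigma_funE; elim: s sJ => [|i s IH] sJ.
  by under eq_fun do rewrite big_nil; exact: measurable_cst.
under eq_fun do rewrite big_cons.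
apply: measurable_funD.
  apply/sigma_funE. apply: (sigma_fun_sub _ (@sigZ i)) => _ ->; apply: sJ.
  by rewrite mem_head.
by apply: IH => j js; apply: sJ; rewrite inE js orbT.
Qed.

Lemma measurable_sumZ (s : seq I) : measurable_fun setT (fun w => \sum_(i <- s) Z i w).
Proof. by apply: (@sigma_fun_measurable _ _ _ _ _ _ _ _ setT); exact: sigma_fun_sum. Qed.

Lemma mgf_sum (s : seq I) l : uniq s ->
  (\int[P]_w (expR (l * \sum_(i <- s) Z i w))%:E = (expR (l ^+ 2 / 2 * (size s)%:R))%:E)%E.
Proof.
elim: s => [_|i s IH /= /andP[ni us]].
  under eq_integral do rewrite big_nil mulr0 expR0.
  by rewrite integral_cst// mul1e mulr0 expR0; exact: probability_setT.
under eq_integral do rewrite big_cons.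
have ms := measurable_sumZ s.
have := @indep_fubini _ _ _ P I X _ R _ R [set i] [set` s] (Z i)
  (fun w => \sum_(j <- s) Z j w)
  (fun z => (expR (l * (z.1 + z.2)))%:E) indepX.
rewrite /= => ->.
- under eq_integral => w _.
    under eq_integral => w' _ do rewrite mulrDr expRD EFinM.
    rewrite ge0_integralZl//; last first.
      apply/measurable_EFinP/measurableT_comp => //; exact: measurable_funM.
    rewrite IH// muleC; over.
  rewrite ge0_integralZl//; last first.
    apply/measurable_EFinP/measurableT_comp => //; apply: measurable_funM => //.
    exact: sigma_fun_measurable (@sigZ i).
  by rewrite mgfZ -EFinM -expRD -natr1; congr (expR _)%:E; ring.
- by apply/seteqP; split => // j [/= -> js]; rewrite js in ni.
- exact: sigZ.
- exact: sigma_fun_sum.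
- apply/measurable_EFinP/measurableT_comp => //; apply: measurable_funM => //.
  exact: measurable_funD.
- by move=> z; rewrite lee_fin expR_ge0.
Qed.

(** With [x = exp (u S / sqrt n)], the moment generating function gives the means of [x] and
    [x ^ 2], whatever [n] is. Off the event [x] is at most [exp (u k)], less than its mean, so the
    event carries the rest; the second moment turns this into a lower bound on its probability. *)
Lemma sum_ge_prob (k : R) : 0 <= k -> exists2 delta : R, 0 < delta &
  forall s : seq I, uniq s -> (0 < size s)%N ->
  (delta%:E <= P [set w | (k * Num.sqrt (size s)%:R <= \sum_(i <- s) Z i w)%R])%E.
Proof.
(* For this [u], [u ^ 2 / 2 - u k = u / 2] is positive, whence [D > 0]. The weight [e] below makes
   the contribution of the second moment equal to [D / 2]. *)
move=> k0; pose u := 2 * k + 1; pose D := expR (u ^+ 2 / 2) - expR (u * k).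
have D0 : 0 < D by rewrite subr_gt0 ltr_expR /u; nra.
pose e := D * expR (- (2 * u ^+ 2)).
have e0 : 0 < e by rewrite mulr_gt0 ?expR_gt0.
exists (e * D) => [|s us s0]; first exact: mulr_gt0.
set n : R := Num.sqrt _; have n0 : 0 < n by rewrite sqrtr_gt0 ltr0n.
have nn : (size s)%:R = n ^+ 2 by rewrite sqr_sqrtr.
set A := [set w | _]; pose S w := \sum_(i <- s) Z i w.
have mS : measurable_fun setT S by exact: measurable_sumZ.
have mA : measurable A by rewrite -[A]setTI; apply: measurable_fun_le.
have mE l : measurable_fun setT (fun w => (expR (l * S w))%:E).
  by apply/measurable_EFinP/measurableT_comp => //; exact: measurable_funM.
have mI : measurable_fun setT (fun w => (\1_A w)%:E : \bar R).
  by apply/measurable_EFinP; exact: measurable_indic.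
have : (\int[P]_w (expR (u / n * S w))%:E <=
   \int[P]_w ((expR (u * k))%:E + ((e / 2)%:E * (expR (2 * u / n * S w))%:E
      + ((2 * e)^-1)%:E * (\1_A w)%:E)))%E.
  apply: ge0_le_integral => //.
  - apply: emeasurable_funD => //; apply: emeasurable_funD;
      exact: measurable_funeM.
  - move=> w _; rewrite -!EFinM -!EFinD lee_fin.
    have -> : expR (2 * u / n * S w) = expR (u / n * S w) ^+ 2.
      by rewrite -expRM_natl; congr expR; field; rewrite gt_eqF.
    rewrite indicE; case: (boolP (w \in A)) => [_|]; last first.
      rewrite notin_setE /A /= => /negP; rewrite -ltNge => lt.
      rewrite mulr0 addr0; apply: ler_wpDr.
        by rewrite mulr_ge0 ?sqr_ge0 ?divr_ge0 ?ltW.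
      rewrite ler_expR -mulrA ler_pM2l ?ler_pdivrMl; [|done|by rewrite /u; lra].
      by rewrite mulrC ltW.
    rewrite mulr1; apply: ler_wpDl; rewrite ?expR_ge0//; set x := expR _.
    (* The inequality between arithmetic and geometric means, its defect written as a square. *)
    have -> : e / 2 * x ^+ 2 + (2 * e)^-1 = x + (e * x - 1) ^+ 2 * (2 * e)^-1.
      by field; rewrite gt_eqF.
    by rewrite lerDl mulr_ge0 ?sqr_ge0// invr_ge0 mulr_ge0// ltW.
have a1 : 0 <= e / 2 by lra.
have a2 : 0 <= (2 * e)^-1 by rewrite invr_ge0; lra.
rewrite mgf_sum// ge0_integralD//; last first.
- by apply: emeasurable_funD => //; exact: measurable_funeM.
- by move=> w _; rewrite adde_ge0// mule_ge0// lee_fin.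
rewrite ge0_integralD//; [|by move=> *; rewrite mule_ge0// lee_fin|
  exact: measurable_funeM|by move=> *; rewrite mule_ge0// lee_fin|exact: measurable_funeM].
rewrite !ge0_integralZl//.
rewrite mgf_sum//.
rewrite integral_indic//.
rewrite setIT.
rewrite (integral_cst P measurableT).
rewrite [X in (_ * X + _)%E](_ : _ = 1%E); last exact: probability_setT.
have -> : (u / n) ^+ 2 / 2 * (size s)%:R = u ^+ 2 / 2.
  by rewrite nn; field; rewrite gt_eqF.
have -> : (2 * u / n) ^+ 2 / 2 * (size s)%:R = 2 * u ^+ 2.
  by rewrite nn; field; rewrite gt_eqF.
have [p pE] : exists p, P A = p%:E.
  by exists (fine (P A)); rewrite fineK// fin_num_measure.
rewrite pE [X in (_ + (_ + _ * X))%E](_ : _ = p%:E)// mule1 -!EFinM -!EFinD !lee_fin.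
have -> : e / 2 * expR (2 * u ^+ 2) = D / 2.
  by rewrite /e mulrAC -[D * _ * _]mulrA -expRD addNr expR0 mulr1.
move=> h.
have : D / 2 <= (2 * e)^-1 * p by rewrite /D in h *; lra.
by rewrite ler_pdivlMl; [lra|lra].
Qed.
End GaussianSums.

(** * Random walks *)

Lemma measurable_ltr_fun (R : realType) (d : measure_display) (T : measurableType d)
    (f g : T -> R) : measurable_fun setT f -> measurable_fun setT g ->
  measurable [set x | f x < g x].
Proof.
move=> mf mg; rewrite (_ : [set x | _] = ~` (setT `&` [set x | g x <= f x])).
  by apply: measurableC; exact: measurable_fun_le.
by rewrite setTI; apply/seteqP; split=> x /=; rewrite ltNge => /negP.
Qed.

Section Lindley.
Context (R : realType) (d : measure_display) (Omega : measurableType d).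
Variable P : probability Omega R.
Context (I : choiceType) (X : I -> {RV P >-> R}).
Hypothesis indepX : independent X.
Variable Z : I -> Omega -> R.
Hypothesis sigZ : forall i, sigma_fun X [set i] (Z i).
Hypothesis mgfZ : forall i l, (\int[P]_w (expR (l * Z i w))%:E = (expR (l ^+ 2 / 2))%:E)%E.

(* Lindley's recursion, adding the increments at the front of the walk. *)
Fixpoint walk_max (c : R) (s : seq I) (w : Omega) : R :=
  if s is i :: s' then Num.max 0 (Z i w - c + walk_max c s' w) else 0.

Lemma walk_max_ge0 c s w : 0 <= walk_max c s w.
Proof. by case: s => //= i s; rewrite le_max lexx. Qed.

Lemma walk_max_take c s n w : (n <= size s)%N ->
  \sum_(i <- take n s) Z i w - c * n%:R <= walk_max c s w.
Proof.
elim: n s => [|n IH] s; first by rewrite take0 big_nil mulr0 subr0 walk_max_ge0.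
case: s => [//|i s] /= /IH; rewrite big_cons => h.
by rewrite le_max -natr1; apply/orP; right; lra.
Qed.

Lemma sigma_fun_walk_max (J : set I) c s : (forall i, i \in s -> J i) ->
  sigma_fun X J (walk_max c s).
Proof.
move=> sJ; apply/sigma_funE; elim: s sJ => [|i s IH] sJ /=.
  exact: measurable_cst.
apply: measurable_maxr => //; apply: measurable_funD.
  apply: measurable_funB => //.
  apply/sigma_funE; apply: (sigma_fun_sub _ (@sigZ i)) => _ ->; apply: sJ.
  by rewrite mem_head.
by apply: IH => j js; apply: sJ; rewrite inE js orbT.
Qed.

(** Induction on the front increment: given [Z i], the bound for the rest at level [x + c - Z i]
    integrates to the same bound, since [expR (2 * c * (Z i - c))] has mean 1. That level may be
    negative, hence all real [x] are covered, the bound being at least 1 there. *)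
Lemma walk_max_tail c s x : 0 <= c -> uniq s ->
  (P [set w | (x < walk_max c s w)%R] <= (expR (- (2 * c * x)))%:E)%E.
Proof.
move=> c0; elim: s x => [|i s IH] x us; have [x0|x0] := ltP x 0.
- rewrite (@le_trans _ _ 1%E) ?probability_le1//.
    rewrite [X in measurable X](_ : _ = setT)//.
    by apply/seteqP; split=> w //= _.
  by rewrite lee_fin -[leLHS]expR0 ler_expR oppr_ge0 mulr_ge0_le0 ?mulr_ge0// ltW.
- rewrite (_ : [set w | _] = set0) ?measure0 ?lee_fin ?expR_ge0//.
  by apply/seteqP; split=> w.
- have mW : measurable_fun setT (walk_max c (i :: s)).
    by apply: (@sigma_fun_measurable _ _ _ _ _ _ _ _ setT); exact: sigma_fun_walk_max.
  rewrite (@le_trans _ _ 1%E) ?probability_le1//.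
    exact: measurable_ltr_fun.
  by rewrite lee_fin -[leLHS]expR0 ler_expR oppr_ge0 mulr_ge0_le0 ?mulr_ge0// ltW.
- have /andP[ni us'] : (i \notin s) && uniq s by [].
  have mW : measurable_fun setT (walk_max c s).
    by apply: (@sigma_fun_measurable _ _ _ _ _ _ _ _ setT); exact: sigma_fun_walk_max.
  have mZ : measurable_fun setT (Z i) by exact: sigma_fun_measurable (@sigZ i).
  pose A := [set z : R * R | x < z.1 - c + z.2].
  have mA : measurable A.
    apply: measurable_ltr_fun => //.
    by apply: measurable_funD => //; exact: measurable_funB.
  have mB y : measurable [set w | x + c - y < walk_max c s w].
    exact: measurable_ltr_fun.
  have -> : [set w | x < walk_max c (i :: s) w] = [set w | A (Z i w, walk_max c s w)].
    by apply/seteqP; split=> w /=; rewrite lt_max ltNge x0.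
  have mAw : measurable [set w | A (Z i w, walk_max c s w)].
    apply: measurable_ltr_fun => //.
    by apply: measurable_funD => //; exact: measurable_funB.
  rewrite -[X in P X]setIT -integral_indic//.
  have := @indep_fubini _ _ _ P I X _ R _ R [set i] [set` s] (Z i)
    (walk_max c s) (fun z => (\1_A z)%:E) indepX.
  rewrite /= => ->.
  + apply: (@le_trans _ _ (\int[P]_w ((expR (- (2 * c * (x + c))))%:E *
                                      (expR (2 * c * Z i w))%:E))%E); last first.
      rewrite ge0_integralZl//; last first.
        by apply/measurable_EFinP/measurableT_comp => //; exact: measurable_funM.
      rewrite mgfZ -EFinM -expRD lee_fin ler_expR; nra.
    apply: ge0_le_integral => //.
    * by move=> w _; apply: integral_ge0 => w' _; rewrite lee_fin.
    * pose A' := [set z : R * Omega | x < z.1 - c + walk_max c s z.2].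
      have mA' : measurable A'.
        apply: measurable_ltr_fun => //; apply: measurable_funD.
          exact: measurable_funB.
        exact: measurableT_comp measurable_snd.
      rewrite (_ : (fun w => _) = fubini_F P (EFin \o \1_A') \o Z i).
        apply: measurableT_comp mZ; apply: measurable_fun_fubini_tonelli_F.
          exact/measurable_EFinP/measurable_indic.
        by move=> z; rewrite lee_fin.
      apply/funext => w; apply: eq_integral => w' _ /=; rewrite !indicE.
      by congr (_ %:R%:E)%R; congr nat_of_bool; apply/idP/idP; rewrite !inE.
    * apply: measurable_funeM.
      by apply/measurable_EFinP/measurableT_comp => //; exact: measurable_funM.
    * move=> w _.
      rewrite (_ : (fun w' => _) = (fun w' => (\1_[set v | x + c - Z i w < walk_max c s v] w')%:E)); last first.
        apply/funext => w'; rewrite !indicE; congr (_ %:R%:E)%R; congr nat_of_bool.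
        by apply/idP/idP; rewrite !inE /A /= => h; lra.
      rewrite integral_indic// setIT (le_trans (IH _ us'))// -EFinM -expRD lee_fin ler_expR; lra.
  + by apply/seteqP; split => // j [/= -> js]; rewrite js in ni.
  + exact: sigZ.
  + exact: sigma_fun_walk_max.
  + exact/measurable_EFinP/measurable_indic.
  + by move=> z; rewrite lee_fin.
Qed.

End Lindley.

Lemma ae_exists_not (R : realType) (d : measure_display) (Omega : measurableType d)
    (P : probability Omega R) (B : nat -> set Omega) :
  (forall x, measurable (B x)) ->
  (forall e : R, 0 < e -> exists x, (P (B x) <= e%:E)%E) ->
  {ae P, forall w, exists x, ~ B x w}.
Proof.
move=> mB hB; have mI : measurable (\bigcap_x B x) by exact: bigcapT_measurable.
exists (\bigcap_x B x); split=> //; last first.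
  by move=> w nw x _; apply: contrapT => nB; apply: nw; exists x.
apply/eqP; rewrite -measure_le0; apply/lee_addgt0Pr => e e0; rewrite add0e.
have [x hx] := hB e e0; apply: le_trans hx.
by apply: le_measure; rewrite ?inE//; exact: bigcap_inf.
Qed.

Section Drift.
Context (R : realType) (d : measure_display) (Omega : measurableType d).
Variable P : probability Omega R.
Context (I : choiceType) (X : I -> {RV P >-> R}).
Hypothesis indepX : independent X.
Variable Z : I -> Omega -> R.
Hypothesis sigZ : forall i, sigma_fun X [set i] (Z i).
Hypothesis mgfZ : forall i l, (\int[P]_w (expR (l * Z i w))%:E = (expR (l ^+ 2 / 2))%:E)%E.
Variable e : nat -> I.
Hypothesis injE : injective e.

Let S n w := \sum_(h < n) Z (e h) w.

Lemma walkE n w : S n w = \sum_(i <- map e (iota 0 n)) Z i w.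
Proof. by rewrite /S big_map -(big_mkord xpredT (fun h => Z (e h) w)) /index_iota subn0. Qed.

Lemma measurable_walk n : measurable_fun setT (S n).
Proof. by rewrite (funext (walkE n)); exact: measurable_sumZ sigZ _. Qed.

Lemma walk_cross_line (c x : R) : 0 <= c ->
  (P (\bigcup_n [set w | (x < S n w - c * n%:R)%R]) <= (expR (- (2 * c * x)))%:E)%E.
Proof.
move=> c0; pose A n := [set w | x < S n w - c * n%:R].
have mA n : measurable (A n).
  apply: measurable_ltr_fun => //; apply: measurable_funB => //.
  exact: measurable_walk.
pose F L := \bigcup_(n in `I_L.+1) A n.
have mF L : measurable (F L) by apply: bigcup_measurable => n _.
have UF : \bigcup_n A n = \bigcup_L F L.
  apply/seteqP; split=> w.
    by move=> [n _ An]; exists n => //; exists n => //=.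
  by move=> [L _ [n _ An]]; exists n.
have mU : measurable (\bigcup_L F L) by exact: bigcupT_measurable.
rewrite -/A UF; have cF := nondecreasing_cvg_mu mF mU.
rewrite -(cvg_lim _ (nondecreasing_cvg_mu mF mU _))//; last first.
  move=> L L' LL'; apply/subsetPset; apply: bigcup_subset => n /= nL.
  exact: leq_trans LL'.
apply: lime_le.
  apply/cvg_ex; eexists; apply: cF => L L' LL'; apply/subsetPset.
  by apply: bigcup_subset => n /= nL; exact: leq_trans LL'.
apply: nearW => L /=.
pose s := map e (iota 0 L).
have us : uniq s by rewrite map_inj_uniq// iota_uniq.
apply: le_trans (walk_max_tail indepX sigZ mgfZ x c0 us).
apply: le_measure; rewrite ?inE//.
  apply: measurable_ltr_fun => //.
  by apply: (@sigma_fun_measurable _ _ _ _ _ _ _ _ setT); exact: sigma_fun_walk_max.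
move=> w [n /= nL]; rewrite /A /= => h; apply: (lt_le_trans h).
have := walk_max_take Z c w (_ : (n <= size s)%N).
rewrite size_map size_iota => /(_ nL); rewrite -map_take take_iota.
by rewrite (minn_idPl _)// -walkE.
Qed.

(** A union bound over [m]: crossing the line of slope [1 / (m + 1)] and height [x (m + 1) ^ 2] has
    probability at most [exp (- 2 x (m + 1))]. All slopes share one [x], so this contains the strong
    law and also quantitative bounds at late times. *)
Lemma walk_growth : {ae P, forall w, exists x : nat, forall m n : nat,
  S n w <= n%:R / m.+1%:R + x%:R * m.+1%:R ^+ 2}.
Proof.
pose A x m n := [set w | x%:R * m.+1%:R ^+ 2 < S n w - m.+1%:R^-1 * n%:R].
have mA x m n : measurable (A x m n).
  apply: measurable_ltr_fun => //; apply: measurable_funB => //.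
  exact: measurable_walk.
pose B x := \bigcup_m \bigcup_n A x m n.
have mB x : measurable (B x).
  by apply: bigcupT_measurable => m; exact: bigcupT_measurable.
have : {ae P, forall w, exists x, ~ B x w}.
  apply: ae_exists_not => // eps eps0.
  have exp1 : expR (- 1) <= 2^-1 :> R.
    by rewrite expRN lef_pV2 ?posrE ?expR_gt0//; have := @expR_ge1Dx R 1; lra.
  have expn k : expR (- k%:R) <= (2 ^ k)%:R^-1 :> R.
    rewrite -mulN1r mulrC expRM_natl natrX -exprVn.
    by rewrite lerXn2r ?nnegrE ?expR_ge0.
  have [x hx] : exists x : nat, (2 ^ x)%:R^-1 <= eps.
    exists (Num.truncn eps^-1).+1; rewrite invf_ple ?posrE ?ltr0n ?expn_gt0//.
    by rewrite (le_trans (ltW (truncnS_gt _)))// ler_nat ltnW// ltn_expl.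
  exists x.+1; apply: (@le_trans _ _ ((2 ^ x)%:R^-1)%:E); last by rewrite lee_fin.
  apply: (@le_trans _ _ (\sum_(m <oo) P (\bigcup_n A x.+1 m n))%E).
    apply: measure_sigma_subadditive => // m; exact: bigcupT_measurable.
  apply: (@le_trans _ _ (\sum_(m <oo) ((2 ^ x)%:R^-1 / (2 ^ m.+1)%:R)%:E)%E); last first.
    exact: epsilon_trick0.
  apply: lee_nneseries => // m _; apply: le_trans (walk_cross_line _ _) _ => //.
  rewrite lee_fin -invfM -natrM -expnD.
  (* As [2 (x + 1) (m + 1) >= x + m + 1], the bounds sum like a geometric series of total at most
     [2 ^ - x]. *)
  apply: (le_trans _ (expn _)); rewrite ler_expR lerN2.
  have -> : 2 * m.+1%:R^-1 * (x.+1%:R * m.+1%:R ^+ 2) = (2 * (x.+1 * m.+1))%:R :> R.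
    by rewrite !natrM; field; rewrite nat1r.
  by rewrite ler_nat; nia.
apply: filterS => w [x nB]; exists x => m n.
rewrite leNgt; apply/negP => h; apply: nB; exists m => //; exists n => //.
by rewrite /A /= [m.+1%:R^-1 * _]mulrC ltrBrDl.
Qed.

End Drift.

(** * Favourable times *)

Section IndependentEvents.
Context (R : realType) (d : measure_display) (Omega : measurableType d).
Variable P : probability Omega R.
Context (I : choiceType) (X : I -> {RV P >-> R}).
Hypothesis indepX : independent X.

Lemma sigma_ofI (J : set I) A B : sigma_of X J A -> sigma_of X J B -> sigma_of X J (A `&` B).
Proof. exact: (@measurableI _ (g_sigma_algebraType (cylinder X J))). Qed.

Lemma sigma_ofC (J : set I) A : sigma_of X J A -> sigma_of X J (~` A).
Proof. exact: (@measurableC _ (g_sigma_algebraType (cylinder X J))). Qed.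

Lemma sigma_ofT (J : set I) : sigma_of X J setT.
Proof. exact: (@measurableT _ (g_sigma_algebraType (cylinder X J))). Qed.

Lemma sigma_of_bigsetI (T : eqType) (J : set I) (E : T -> set Omega) (s : seq T) :
  (forall t, t \in s -> sigma_of X J (E t)) -> sigma_of X J (\big[setI/setT]_(t <- s) E t).
Proof.
move=> sE; rewrite big_seq; elim/big_ind: _ => //; [exact: sigma_ofT|exact: sigma_ofI].
Qed.

Lemma indep_bigsetI (T : eqType) (J : T -> set I) (E : T -> set Omega) (s : seq T) :
  uniq s -> (forall t u, t != u -> J t `&` J u = set0) ->
  (forall t, sigma_of X (J t) (E t)) ->
  P (\big[setI/setT]_(t <- s) E t) = (\prod_(t <- s) P (E t))%E.
Proof.
move=> us dJ sE; elim: s us => [|t s IH] /=.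
  by rewrite !big_nil => _; exact: probability_setT.
move=> /andP[nts us]; rewrite !big_cons -IH//.
apply: (@indep_sigma_of _ _ _ _ _ _ (J t) [set i | exists2 u, u \in s & J u i] indepX) => //.
  apply/seteqP; split=> // i [Jt [u us' Ju]].
  have tu : t != u by apply: contraNneq nts => ->.
  by rewrite -(dJ _ _ tu).
apply: sigma_of_bigsetI => u us'.
by apply: sigma_of_sub (sE u) => i Ji; exists u.
Qed.

(** The part of the Borel-Cantelli lemma that rests on independence: from any rank on, [x]
    consecutive events all fail with probability at most [(1 - delta) ^+ x]. *)
Lemma indep_infinitely_often (J : nat -> set I) (E : nat -> set Omega) (delta : R) :
  (forall j j', j != j' -> J j `&` J j' = set0) ->
  (forall j, sigma_of X (J j) (E j)) ->
  0 < delta -> (forall j, (delta%:E <= P (E j))%E) ->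
  {ae P, forall w, forall n, exists2 j, (n <= j)%N & E j w}.
Proof.
move=> dJ sE d0 dE; apply: ae_foralln => n.
have mE j : measurable (E j) by exact: sigma_of_measurable (sE j).
pose B x := \big[setI/setT]_(j <- iota n x) ~` E j.
have mB x : measurable (B x).
  by apply: bigsetI_measurable => j _; exact: measurableC.
have d1 : delta <= 1.
  by rewrite -lee_fin (le_trans (dE 0%N))// probability_le1.
have PB m x : (P (\big[setI/setT]_(j <- iota m x) ~` E j) <= ((1 - delta) ^+ x)%:E)%E.
  rewrite (indep_bigsetI _ dJ) ?iota_uniq//; last by move=> j; exact: sigma_ofC.
  elim: x m => [|x IH] m; first by rewrite big_nil expr0.
  rewrite /= big_cons exprS EFinM; apply: lee_pmul => //.
    by apply: prode_ge0 => j _; exact: measure_ge0.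
  by rewrite probability_setC// EFinB leeB.
have : {ae P, forall w, exists x, ~ B x w}.
  apply: ae_exists_not => // e e0.
  have : (1 - delta) ^+ x @[x --> \oo] --> 0.
    by apply: cvg_expr; rewrite ger0_norm; lra.
  move=> /cvgrPdist_lt /(_ e e0) [x _ /(_ x (leqnn _)) /=].
  rewrite sub0r normrN ger0_norm ?exprn_ge0 ?subr_ge0// => /ltW xe.
  by exists x; rewrite (le_trans (PB n x))// lee_fin.
apply: filterS => w [x]; apply: contra_notP => nE.
rewrite /B -bigcap_seq => j /=; rewrite mem_iota => /andP[nj _] Ej; apply: nE.
by exists j.
Qed.

End IndependentEvents.

Lemma sigma_of_le (R : realType) (d : measure_display) (Omega : measurableType d)
    (P : probability Omega R) (I : choiceType) (X : I -> {RV P >-> R}) (J : set I)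
    (f g : Omega -> R) : sigma_fun X J f -> sigma_fun X J g ->
  sigma_of X J [set w | f w <= g w].
Proof.
move=> /sigma_funE mf /sigma_funE mg.
have := measurable_fun_le (@measurableT _ (g_sigma_algebraType (cylinder X J))) mf mg.
by rewrite setTI.
Qed.

Lemma sigma_fun_cst (R : realType) (d : measure_display) (Omega : measurableType d)
    (P : probability Omega R) (I : choiceType) (X : I -> {RV P >-> R}) (J : set I)
    (c : R) : sigma_fun X J (fun=> c).
Proof. by apply/sigma_funE; exact: measurable_cst. Qed.

Section Blocks.
Context (R : realType) (d : measure_display) (Omega : measurableType d).
Variable P : probability Omega R.
Variable D : finType.
Let I : choiceType := (nat * D)%type.
Variable X : I -> {RV P >-> R}.
Hypothesis indepX : independent X.
Variable Z : I -> Omega -> R.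
Hypothesis sigZ : forall i, sigma_fun X [set i] (Z i).
Hypothesis mgfZ : forall i l, (\int[P]_w (expR (l * Z i w))%:E = (expR (l ^+ 2 / 2))%:E)%E.

Let NZ i w := - Z i w.

Let sigNZ i : sigma_fun X [set i] (NZ i).
Proof.
by apply/sigma_funE; apply: measurable_funN; apply/sigma_funE; exact: sigZ.
Qed.

Let mgfNZ i l : (\int[P]_w (expR (l * NZ i w))%:E = (expR (l ^+ 2 / 2))%:E)%E.
Proof.
have := mgfZ i (- l); rewrite sqrrN => <-.
by apply: eq_integral => w _; rewrite /NZ mulrN mulNr.
Qed.

Let times (p : D) m n := [seq (h, p) | h <- index_iota m n].

Let uniq_times p m n : uniq (times p m n).
Proof. by rewrite map_inj_uniq ?iota_uniq// => x y []. Qed.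

Let mem_times p m n i : (i \in times p m n) = (m <= i.1 < n)%N && (i.2 == p).
Proof.
apply/mapP/idP => [[h]|/andP[]]; first by rewrite mem_index_iota => ? -> /=; rewrite eqxx andbT.
by case: i => h p' /= ? /eqP ->; exists h; rewrite ?mem_index_iota.
Qed.

(* [a ^ 2] is going to be a favourable time for [p]; the event depends only on
   the times in [a, a ^ 4), so that it is independent of other blocks. *)
Let block (r k : R) (a : nat) (p : D) : set Omega :=
  [set w | 6 * k * a%:R <= \sum_(i <- times p a (a ^ 2)) Z i w] `&`
  ([set w | Z ((a ^ 2)%N, p) w <= - 1] `&`
   [set w | walk_max NZ (k / (r * a%:R)) (times p (a ^ 2) (a ^ 4)) w <= k * a%:R]).

Let climb_sigma k a p (J : set I) : (forall h, (a <= h < a ^ 2)%N -> J (h, p)) ->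
  sigma_of X J [set w | 6 * k * a%:R <= \sum_(i <- times p a (a ^ 2)) Z i w].
Proof.
move=> Jp; apply: sigma_of_le; first exact: sigma_fun_cst.
apply: sigma_fun_sum sigZ _ _ _ => -[h p']; rewrite mem_times /= => /andP[? /eqP ->].
exact: Jp.
Qed.

Let step_sigma a p (J : set I) : J ((a ^ 2)%N, p) ->
  sigma_of X J [set w | Z ((a ^ 2)%N, p) w <= - 1].
Proof.
move=> Jp; apply: sigma_of_le; last exact: sigma_fun_cst.
by apply: (sigma_fun_sub _ (@sigZ _)) => _ ->.
Qed.

Let stay_sigma r k a p (J : set I) : (forall h, (a ^ 2 <= h < a ^ 4)%N -> J (h, p)) ->
  sigma_of X J
   [set w | walk_max NZ (k / (r * a%:R)) (times p (a ^ 2) (a ^ 4)) w <= k * a%:R].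
Proof.
move=> Jp; apply: sigma_of_le; last exact: sigma_fun_cst.
apply: sigma_fun_walk_max sigNZ _ _ _ _ => -[h p']; rewrite mem_times /= => /andP[? /eqP ->].
exact: Jp.
Qed.

Let block_sigma r k a p : (1 < a)%N ->
  sigma_of X [set i | (a <= i.1 < a ^ 4)%N && (i.2 == p)] (block r k a p).
Proof.
move=> a1; have le1 : (a <= a ^ 2)%N by nia.
have le2 : (a ^ 2 < a ^ 4)%N by rewrite ltn_exp2l.
apply: sigma_ofI; [|apply: sigma_ofI].
- by apply: climb_sigma => h /= ?; rewrite eqxx andbT; lia.
- by apply: step_sigma => /=; rewrite eqxx andbT; lia.
- by apply: stay_sigma => h /= ?; rewrite eqxx andbT; lia.
Qed.

(** The climb depends on times before [a ^ 2] and is independent of the other two events, which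
    depend on times from [a ^ 2] on. These two share the observation at [a ^ 2]; a union bound
    suffices for them, since [walk_max] exceeds its allowance with probability at most half the
    lower bound [d2] for the downward step. *)
Let block_prob r : 1 <= r -> exists k0 : R, forall k, k0 <= k -> exists2 delta : R, 0 < delta &
  forall a p, (1 < a)%N -> (delta%:E <= P (block r k a p))%E.
Proof.
move=> r1; have [d2 d20 hd2] := sum_ge_prob indepX sigNZ mgfNZ ler01.
(* From [k >= 1] and [k >= r / d2] follows [exp (- 2 k ^ 2 / r) <= d2 / 2]. *)
exists (r / d2 + 1) => k kk0.
have e0 : 0 < r / d2 by rewrite divr_gt0; lra.
have k0 : 0 < k by lra.
(* Twice [6 * k], because the climb has only [a ^ 2 - a] increments and the square root of this is
   at least [a / 2]. *)
have k12 : 0 <= 12 * k by lra.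
have [d1 d10 hd1] := sum_ge_prob indepX sigZ mgfZ k12.
exists (d1 * (d2 / 2)) => [|a p a1]; first by rewrite mulr_gt0// divr_gt0.
have le1 : (a < a ^ 2)%N by nia.
have le2 : (a ^ 2 < a ^ 4)%N by rewrite ltn_exp2l.
have aR : 2 <= a%:R :> R by rewrite ler_nat.
pose J1 := [set i : I | (i.1 < a ^ 2)%N]; pose J2 := [set i : I | (a ^ 2 <= i.1)%N].
have s1 : sigma_of X J1 [set w | 6 * k * a%:R <= \sum_(i <- times p a (a ^ 2)) Z i w].
  by apply: climb_sigma => h /= /andP[].
have s2 : sigma_of X J2 [set w | Z ((a ^ 2)%N, p) w <= - 1].
  by apply: step_sigma; rewrite /J2 /=.
have s3 : sigma_of X J2
   [set w | walk_max NZ (k / (r * a%:R)) (times p (a ^ 2) (a ^ 4)) w <= k * a%:R].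
  by apply: stay_sigma => h /= /andP[].
have J12 : J1 `&` J2 = set0.
  by apply/seteqP; split=> // i [] /=; rewrite /J1 /J2 /=; lia.
rewrite /block (indep_sigma_of indepX J12 s1 (sigma_ofI s2 s3)).
rewrite EFinM; apply: lee_pmul;
  [by rewrite lee_fin ltW|by rewrite lee_fin divr_ge0// ltW| |].
  apply: (le_trans (hd1 _ (uniq_times p a (a ^ 2)) _)).
    by rewrite size_map size_iota subn_gt0.
  apply: le_measure; rewrite ?inE.
  - apply: (@sigma_of_measurable _ _ _ _ _ X setT); apply: sigma_of_le; first exact: sigma_fun_cst.
    exact: sigma_fun_sum.
  - exact: sigma_of_measurable s1.
  - move=> w /=; apply: le_trans.
    rewrite size_map size_iota.
    have : a%:R / 2 <= Num.sqrt (a ^ 2 - a)%:R :> R.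
      rewrite -[leLHS]ger0_norm ?divr_ge0// -sqrtr_sqr ler_sqrt ?ler0n//.
      by rewrite natrB 1?ltnW// natrX; nra.
    by nra.
set A2 := [set w | Z _ w <= _]; set A3 := [set w | walk_max _ _ _ _ <= _].
have m2 : measurable A2 by exact: sigma_of_measurable s2.
have m3 : measurable A3 by exact: sigma_of_measurable s3.
have p2 : (d2%:E <= P A2)%E.
  apply: (le_trans (hd2 [:: ((a ^ 2)%N, p)] isT isT)).
  rewrite (_ : [set w | _] = A2)//; apply/seteqP.
  by split=> w; rewrite /A2 /= big_seq1 /NZ /= sqrtr1 mulr1; lra.
have p3 : (P (~` A3) <= (d2 / 2)%:E)%E.
  rewrite (_ : ~` A3 = [set w | k * a%:R < walk_max NZ (k / (r * a%:R)) (times p (a ^ 2) (a ^ 4)) w]).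
    apply: le_trans (walk_max_tail indepX sigNZ mgfNZ _ _ (uniq_times _ _ _)) _.
      by rewrite divr_ge0 ?mulr_ge0 //; lra.
    rewrite lee_fin.
    have -> : 2 * (k / (r * a%:R)) * (k * a%:R) = 2 * k ^+ 2 / r.
      by field; lra.
    have h1 := @expR_ge1Dx R (2 * k ^+ 2 / r).
    have h2 : 2 / d2 <= 2 * k ^+ 2 / r.
      rewrite ler_pdivlMr; last by lra.
      by rewrite (_ : 2 / d2 * r = 2 * (r / d2)); [nra|ring].
    rewrite expRN -[d2 / 2]invrK lef_pV2 ?posrE ?expR_gt0 ?invr_gt0 ?divr_gt0//.
    by rewrite invf_div; lra.
  by apply/seteqP; split=> w; rewrite /A3 /= ltNge => /negP.
have : (P A2 <= P (A2 `&` A3) + P (~` A3))%E.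
  have m23 : measurable (A2 `&` A3) by exact: measurableI.
  have mC : measurable (~` A3) by exact: measurableC.
  apply: (@le_trans _ _ (P ((A2 `&` A3) `|` ~` A3))); last exact: measureU2.
  apply: le_measure; rewrite ?inE//; first exact: measurableU.
  by move=> w ?; have [?|?] := pselect (A3 w); [left|right].
have fA : P (A2 `&` A3) \is a fin_num by rewrite fin_num_measure//; exact: measurableI.
have fC : P (~` A3) \is a fin_num by rewrite fin_num_measure//; exact: measurableC.
have f2 : P A2 \is a fin_num by rewrite fin_num_measure.
move: p2 p3; rewrite -(fineK fA) -(fineK fC) -(fineK f2) -EFinD !lee_fin; lra.
Qed.

(** Each scale is the fourth power of the preceding one, so the blocks of times
    [[scale j, scale j ^ 4)] are disjoint. *)
Let scale j : nat := (2 ^ (4 ^ j))%N.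

Let scaleX j j' : (j < j')%N -> (scale j ^ 4 <= scale j')%N.
Proof.
by move=> jj'; rewrite /scale -expnM leq_exp2l// mulnC -expnS leq_exp2l.
Qed.

Let scale_gt1 j : (1 < scale j)%N.
Proof. by rewrite /scale -{1}(expn0 2) ltn_exp2l// expn_gt0. Qed.

Let scale_ge j : (j <= scale j)%N.
Proof.
apply: leq_trans (ltnW (ltn_expl _ (isT : 1 < 2)%N)) _.
by apply: leq_pexp2l => //; exact: (ltnW (ltn_expl _ _)).
Qed.

Let blocks_io r : 1 <= r -> exists k0 : R, forall k, k0 <= k ->
  {ae P, forall w, forall n, exists2 j, (n <= j)%N & forall p, block r k (scale j) p w}.
Proof.
move=> r1; have [k0 hk0] := block_prob r1; exists k0 => k /hk0 [delta d0 hd].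
pose J (j : nat) := [set i : I | (scale j <= i.1 < scale j ^ 4)%N].
(* All pairs are required to succeed at the same scale; by independence across pairs this still has
   probability at least [delta ^+ #|D|]. *)
pose E j := \big[setI/setT]_(p <- enum D) block r k (scale j) p.
have dJ j j' : j != j' -> J j `&` J j' = set0.
  move=> jj'; apply/seteqP; split=> // i [/= /andP[h1 h2] /andP[h3 h4]].
  by move: jj'; rewrite neq_ltn => /orP[] /scaleX; lia.
have sE j : sigma_of X (J j) (E j).
  apply: sigma_of_bigsetI => p _.
  apply: (sigma_of_sub _ (@block_sigma r k _ p (scale_gt1 j))).
  by move=> i /andP[].
have PE j : ((delta ^+ #|D|)%:E <= P (E j))%E.
  rewrite (indep_bigsetI indepX _ _ (fun p => @block_sigma r k _ p (scale_gt1 j))).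
  - rewrite cardE; elim: (enum D) => [|p s IH]; first by rewrite big_nil expr0.
    rewrite big_cons exprS EFinM; apply: lee_pmul => //; last exact: hd.
    + by rewrite lee_fin ltW.
    + by rewrite lee_fin exprn_ge0// ltW.
  - exact: enum_uniq.
  - move=> p p' pp'; apply/seteqP; split=> // i [/= /andP[_ /eqP e1] /andP[_ /eqP e2]].
    by move: pp'; rewrite -e1 -e2 eqxx.
have := indep_infinitely_often indepX dJ sE (exprn_gt0 _ d0) PE.
apply: filterS => w h n; have [j nj Ej] := h n; exists j => // p.
by move: Ej; rewrite /E -bigcap_seq; apply; rewrite /= mem_enum.
Qed.

(** Within the block the walk is controlled by the block event, before and after it by
    [walk_growth]. The climb of [6 k a] leaves room for the uncontrolled start, the allowance [k a]
    of [walk_max] and the drift. *)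
Lemma favourable_times r : 1 <= r -> exists k0 : R, forall k, k0 <= k ->
  {ae P, forall w, forall n0 : nat, exists2 a, (n0 <= a)%N & forall p,
   [/\ Z ((a ^ 2)%N, p) w <= - 1,
       2 * k * a%:R <= \sum_(h < a ^ 2) Z (nat_of_ord h, p) w,
       2 * k * a%:R <= \sum_(h < (a ^ 2).+1) Z (nat_of_ord h, p) w &
       forall n, (a ^ 2 <= n)%N ->
         - (k / r * (n%:R / a%:R)) <= \sum_(h < n) Z (nat_of_ord h, p) w]}.
Proof.
move=> r1; have [k0 hk0] := blocks_io r1; exists (Num.max k0 (16 * r)) => k; rewrite ge_max => /andP[/hk0 io kr].
have growth : {ae P, forall w, forall p, exists x : nat, forall m n : nat,
    \sum_(h < n) NZ (nat_of_ord h, p) w <= n%:R / m.+1%:R + x%:R * m.+1%:R ^+ 2}.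
  apply: filter_forall => p.
  by apply: (walk_growth indepX sigNZ mgfNZ (e := fun h => (h, p))) => x y [].
apply: filterS2 io growth => w io growth n0.
have [x hx] : exists x : nat, forall p m n,
    - (n%:R / m.+1%:R + x%:R * m.+1%:R ^+ 2) <= \sum_(h < n) Z (nat_of_ord h, p) w.
  have [f hf] := choice growth; exists (\max_p f p) => p m n.
  have := hf p m n; rewrite sumrN lerNl; apply: le_trans.
  by rewrite lerN2 lerD2l ler_wpM2r ?sqr_ge0// ler_nat leq_bigmax.
have [j nj hj] := io (maxn n0 x); have := scale_ge j; have := scale_gt1 j.
move: (scale j) hj => a hj a1 ja.
have [n0a xa] : (n0 <= a)%N /\ (x <= a)%N by split; move: nj ja; rewrite geq_max; lia.
exists a => // p; have [h1 [h2 h3]] := hj p.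
pose S n := \sum_(h < n) Z (nat_of_ord h, p) w.
have sumS m n : (m <= n)%N -> \sum_(i <- times p m n) Z i w = S n - S m.
  move=> mn; rewrite big_map /S -!(big_mkord xpredT (fun h => Z (h, p) w)).
  by rewrite (@big_cat_nat _ _ _ m 0 n)//= addrC addrK.
have aR : 2 <= a%:R :> R by rewrite ler_nat.
have xR : x%:R <= a%:R :> R by rewrite ler_nat.
have le1 : (a <= a ^ 2)%N by nia.
have le2 : (a ^ 2 < a ^ 4)%N by rewrite ltn_exp2l.
have k16 : 16 <= k by lra.
(* Slope 1, with an intercept [x] that is at most [a] by the choice of the block. *)
have Sa : - (2 * a%:R) <= S a.
  by apply: le_trans (hx p 0 a); rewrite invr1 mulr1 expr1n mulr1; lra.
have SN : 5 * k * a%:R <= S (a ^ 2)%N.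
  by move: h1 => /=; rewrite sumS//; nra.
have step n : (a ^ 2 <= n <= a ^ 4)%N ->
    S (a ^ 2)%N - k * a%:R - k / (r * a%:R) * (n - a ^ 2)%:R <= S n.
  move=> /andP[n1 n2].
  have := @walk_max_take _ _ _ _ NZ (k / (r * a%:R)) (times p (a ^ 2) (a ^ 4)) (n - a ^ 2) w.
  rewrite size_map size_iota leq_sub2r// => /(_ isT).
  rewrite -map_take take_iota (minn_idPl _) ?leq_sub2r//.
  rewrite -/(times p (a ^ 2) n) /NZ sumrN sumS// => h.
  by move: h3 => /=; lra.
have ka : 32 <= k * a%:R by nra.
have c0 : k / (r * a%:R) <= k / 2.
  by rewrite ler_pM2l; [rewrite lef_pV2 ?posrE; nra|lra].
split => //.
- by rewrite -/(S _); lra.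
- rewrite -/(S _); apply: le_trans (step _ _); last by lia.
  by rewrite subSnn mulr1; nra.
- move=> n an; rewrite -/(S n).
  have dn : k / (r * a%:R) * n%:R = k / r * (n%:R / a%:R).
    by field; rewrite !gt_eqF; lra.
  have [nb|bn] := leqP n (a ^ 4).
    apply: le_trans (step n _); last by rewrite an.
    rewrite -dn natrB//.
    have : 0 <= k / (r * a%:R) * (a ^ 2)%:R.
      by rewrite mulr_ge0 ?ler0n// divr_ge0 ?mulr_ge0//; lra.
    by nra.
  (* Past the block, slope [1 / a]: the intercept [x a ^ 2 <= a ^ 3] is at most [n / a] because
     [n > a ^ 4], and [2 n / a] is allowed because [k >= 16 r]. *)
  have := hx p a.-1 n; rewrite prednK ?(ltnW a1)// -/(S n); apply: le_trans.
  rewrite lerN2; apply: (@le_trans _ _ (2 * (n%:R / a%:R))); last first.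
    by rewrite ler_wpM2r ?divr_ge0// ler_pdivlMr; lra.
  rewrite mulr2n mulrDl mul1r lerD2l ler_pdivlMr; last by lra.
  have : (a ^ 4)%:R <= n%:R :> R by rewrite ler_nat ltnW.
  rewrite natrX; apply: le_trans.
  rewrite (_ : a%:R ^+ 4 = a%:R * a%:R ^+ 2 * a%:R); last by ring.
  by rewrite ler_pM2r ?ler_pM2r ?exprn_gt0//; lra.
Qed.

End Blocks.

(** * Posterior means and variances *)

Section Posterior.
Context (R : realType) (sd pmean : R) (psd : \bar R).
Hypotheses (sd_gt0 : 0 < sd) (psd_gt0 : (0 < psd)%E).

(** The prior counts as [c] additional observations of value [pmean]; [c] is 0 for an uninformative
    prior. *)
Let c := prior_precision psd * sd ^+ 2.

Lemma prior_weight_ge0 : 0 <= c.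
Proof.
apply: mulr_ge0; last exact: sqr_ge0.
by rewrite /prior_precision fine_ge0// inve_ge0 expe_ge0// ltW.
Qed.

Lemma post_varE n : post_var sd psd n = sd ^+ 2 / (c + n%:R).
Proof.
have -> : post_var sd psd n = ((c + n%:R) / sd ^+ 2)^-1.
  by rewrite /post_var mulrDl mulfK// expf_neq0// gt_eqF.
by rewrite invf_div.
Qed.

Lemma post_meanE (y : nat -> R) n : (0 < n)%N ->
  post_mean sd pmean psd y n = (c * pmean + \sum_(h < n) y h) / (c + n%:R).
Proof.
move=> n0; rewrite /post_mean post_varE /sample_mean mulVKf ?pnatr_eq0 -?lt0n//.
have := prior_weight_ge0; have : 0 < n%:R :> R by rewrite ltr0n.
by rewrite /c => ? ?; field; rewrite !gt_eqF//; lra.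
Qed.

Lemma post_var_gt0 n : (0 < n)%N -> 0 < post_var sd psd n.
Proof.
move=> n0; rewrite post_varE divr_gt0 ?exprn_gt0//.
by rewrite ltr_wpDl ?prior_weight_ge0// ltr0n.
Qed.

Lemma post_var_ge0 n : 0 <= post_var sd psd n.
Proof. by rewrite post_varE divr_ge0 ?sqr_ge0// addr_ge0// prior_weight_ge0. Qed.

Lemma post_var_lt m n : (0 < m)%N -> (m < n)%N -> post_var sd psd n < post_var sd psd m.
Proof.
move=> m0 mn; have := prior_weight_ge0 => c0.
have m0' : 0 < m%:R :> R by rewrite ltr0n.
have mn' : m%:R < n%:R :> R by rewrite ltr_nat.
by rewrite !post_varE ltr_pM2l ?exprn_gt0// ltf_pV2 ?posrE; lra.
Qed.

Lemma post_var_le n : (0 < n)%N -> post_var sd psd n <= sd ^+ 2 / n%:R.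
Proof.
move=> n1; have c0 := prior_weight_ge0.
have n0 : 0 < n%:R :> R by rewrite ltr0n.
by rewrite post_varE ler_pM2l ?exprn_gt0// lef_pV2 ?posrE; lra.
Qed.

End Posterior.

(** * Genericity *)

Lemma ae_forall_countable (R : realType) (d : measure_display) (Omega : measurableType d)
    (P : probability Omega R) (T : countType) (Q : T -> Omega -> Prop) :
  (forall t, {ae P, forall w, Q t w}) -> {ae P, forall w, forall t, Q t w}.
Proof.
move=> h.
have : {ae P, forall w, forall n, if unpickle n is Some t then Q t w else True}.
  by apply: ae_foralln => n; case: unpickle => [t|]; [exact: h|exact: aeW].
by apply: filterS => w hw t; have := hw (pickle t); rewrite pickleK.
Qed.

Section Generic.
Context (R : realType) (d : measure_display) (Omega : measurableType d).
Variable P : probability Omega R.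
Variable D : finType.
Let I : choiceType := (nat * D)%type.
Variable X : I -> {RV P >-> R}.
Hypothesis indepX : independent X.
Hypothesis atomless : forall i x, P (X i @^-1` [set x]) = 0%E.

(** [g] is independent of [X i], and for a fixed value of [g] equality is the event that [X i] hits
    one point, of probability 0. *)
Lemma indep_neq i (J : set I) (g : Omega -> R) : ~ J i -> sigma_fun X J g ->
  {ae P, forall w, X i w <> g w}.
Proof.
move=> nJi mg; pose E := [set w | X i w = g w].
have mg' := sigma_fun_measurable mg.
pose A := [set z : R * R | z.1 = z.2].
have mA : measurable A.
  rewrite (_ : A = (setT `&` [set z | z.1 <= z.2]) `&` (setT `&` [set z | z.2 <= z.1])).
    by apply: measurableI; exact: measurable_fun_le.
  rewrite !setTI; apply/seteqP; split=> z; rewrite /A /=; first by move=> ->; split.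
  by move=> [? ?]; apply/eqP; rewrite eq_le; apply/andP.
have mE : measurable E.
  rewrite (_ : E = (setT `&` [set w | X i w <= g w]) `&` (setT `&` [set w | g w <= X i w])).
    by apply: measurableI; exact: measurable_fun_le.
  rewrite !setTI; apply/seteqP; split=> z; rewrite /E /=; first by move=> ->; split.
  by move=> [? ?]; apply/eqP; rewrite eq_le; apply/andP.
exists E; split=> //; last by move=> w /= /contrapT.
rewrite -[X in P X]setIT -integral_indic//.
have := @indep_fubini _ _ _ P I X _ R _ R J [set i] g (X i)
  (fun z => (\1_A z)%:E) indepX.
rewrite (_ : (fun w => (\1_E w)%:E) = (fun w => (\1_A (g w, X i w))%:E)); last first.
  apply/funext => w; rewrite !indicE; congr (_ %:R%:E)%R; congr nat_of_bool.
  by apply/idP/idP; rewrite !inE /A /E /= => ->.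
rewrite /= => ->.
- apply: integral0_eq => w _.
  rewrite (_ : (fun w' => _) = (fun w' => (\1_(X i @^-1` [set g w]) w')%:E)).
    have mS : measurable (X i @^-1` [set g w]).
      by rewrite -[X in measurable X]setTI; exact: measurable_funP.
    by rewrite integral_indic// setIT; exact: atomless.
  apply/funext => w'; rewrite !indicE; congr (_ %:R%:E)%R; congr nat_of_bool.
  by apply/idP/idP; rewrite !inE /A /= => ->.
- by apply/seteqP; split=> // j [/= Jj ji]; rewrite ji in Jj.
- exact: mg.
- exact: sigma_fun_var.
- exact/measurable_EFinP/measurable_indic.
- by move=> z; rewrite lee_fin.
Qed.

Variables (sd pmean ymean : D -> R) (psd : D -> \bar R).
Hypothesis sd_gt0 : forall p, 0 < sd p.
Hypothesis psd_gt0 : forall p, (0 < psd p)%E.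

Let M p n w := post_mean (sd p) (pmean p) (psd p) (fun h => X (h, p) w) n.
Let V p n := post_var (sd p) (psd p) n.

(* [None] stands for infinitely many replications. *)
Definition config_mean p o w := if o is Some n then M p n w else ymean p.
Definition config_var p o := if o is Some n then V p n else 0.

(** Everything but the first observation of [p]. After at least one replication the posterior mean
    of [p] is affine and nonconstant in that observation, which is the source of genericity. *)
Let J p := ~` [set ((0%N, p) : I)].

Let sum_sigma (p : D) (K : set I) m n : (forall h, (m <= h < n)%N -> K (h, p)) ->
  sigma_fun X K (fun w => \sum_(m <= h < n) X (h, p) w).
Proof.
move=> Kp.
rewrite (_ : (fun w => _) = (fun w => \sum_(i <- [seq (h, p) | h <- index_iota m n]) X i w)).
  apply: (@sigma_fun_sum _ _ _ _ _ X (fun i => X i : Omega -> R)).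
    by move=> i; exact: sigma_fun_var.
  by move=> i /mapP[h]; rewrite mem_index_iota => hm ->; exact: Kp.
by apply/funext => w; rewrite big_map.
Qed.

Let config_mean_sigma p p' o : p' != p -> sigma_fun X (J p) (config_mean p' o).
Proof.
move=> pp'; case: o => [n|]; last exact: sigma_fun_cst.
have h := @sum_sigma p' (J p) 0 n.
rewrite /config_mean /M /post_mean /sample_mean.
apply/sigma_funE; apply: measurable_funM => //; apply: measurable_funD => //.
apply: measurable_funM => //; apply: measurable_funM => //; apply: measurable_funM => //.
rewrite (_ : (fun x => _) = (fun w => \sum_(0 <= h < n) X (h, p') w)).
  by apply/sigma_funE; apply: h => h _ /= [_ e]; rewrite e eqxx in pp'.
by apply/funext => w; rewrite big_mkord.
Qed.

Let config_neq p n g : sigma_fun X (J p) g -> {ae P, forall w, M p n.+1 w <> g w}.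
Proof.
move=> sg; set c := prior_precision (psd p) * sd p ^+ 2 + n.+1%:R.
have c0 : 0 < c by rewrite ltr_wpDl ?prior_weight_ge0// ltr0n.
pose A w := prior_precision (psd p) * sd p ^+ 2 * pmean p + \sum_(1 <= h < n.+1) X (h, p) w.
have sA : sigma_fun X (J p) (fun w => c * g w - A w).
  apply/sigma_funE; apply: measurable_funB; first by apply: measurable_funM => //; exact/sigma_funE.
  apply: measurable_funD => //; apply/sigma_funE; apply: sum_sigma => h /andP[h0 _] /= [h1].
  by rewrite h1 in h0.
have nJ : ~ J p (0%N, p) by move=> /(_ erefl).
apply: filterS (indep_neq nJ sA) => w; apply: contra_not => Mg.
have : c * M p n.+1 w = A w + X (0%N, p) w.
  rewrite /M post_meanE// -/c mulrC divfK ?gt_eqF// /A.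
  rewrite -(big_mkord xpredT (fun h => X (h, p) w)) big_ltn//; ring.
by rewrite Mg => ->; ring.
Qed.

(** Counts range over a countable set, so one null set serves all of them; infinite counts are
    included for the sake of limits. *)
Lemma generic : {ae P, forall w,
  (forall p n p' o, p' != p -> M p n.+1 w != config_mean p' o w) /\
  (forall p n p2 p3 p4 o2 o3 o4, p2 != p -> p3 != p -> p4 != p ->
     (M p n.+1 w - config_mean p2 o2 w) ^+ 2 / (V p n.+1 + config_var p2 o2) !=
     (config_mean p3 o3 w - config_mean p4 o4 w) ^+ 2 /
       (config_var p3 o3 + config_var p4 o4))}.
Proof.
have h1 : {ae P, forall w, forall t : D * nat * D * option nat,
    let '(p, n, p', o) := t in p' != p -> M p n.+1 w != config_mean p' o w}.
  apply: ae_forall_countable => -[[[p n] p'] o].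
  have [->|pp'] := eqVneq p' p; first exact: aeW.
  by apply: filterS (config_neq n (config_mean_sigma o pp')) => w /eqP.
have h2 : {ae P, forall w, forall t : D * nat * D * D * D * option nat * option nat * option nat,
    let '(p, n, p2, p3, p4, o2, o3, o4) := t in
    p2 != p -> p3 != p -> p4 != p ->
     (M p n.+1 w - config_mean p2 o2 w) ^+ 2 / (V p n.+1 + config_var p2 o2) !=
     (config_mean p3 o3 w - config_mean p4 o4 w) ^+ 2 /
       (config_var p3 o3 + config_var p4 o4)}.
  apply: ae_forall_countable => -[[[[[[[p n] p2] p3] p4] o2] o3] o4].
  have [->|pp2] := eqVneq p2 p; first exact: aeW.
  have [->|pp3] := eqVneq p3 p; first exact: aeW.
  have [->|pp4] := eqVneq p4 p; first exact: aeW.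
  set v := V p n.+1 + _; set v' := config_var p3 _ + _.
  have v0 : 0 < v.
    rewrite ltr_wpDr ?post_var_gt0// /config_var; case: (o2) => // m.
    exact: post_var_ge0.
  (* Equal terms force the mean of [p] to be [config_mean p2 o2 w] plus or minus [s w], and neither
     value involves the first observation of [p]. *)
  pose s w := Num.sqrt ((config_mean p3 o3 w - config_mean p4 o4 w) ^+ 2 / v' * v).
  have ms : sigma_fun X (J p) s.
    apply/sigma_funE; apply: (measurableT_comp (continuous_measurable_fun (@sqrt_continuous R))).
    apply: measurable_funM => //; apply: measurable_funM => //; apply: measurable_funX.
    by apply: measurable_funB; apply/sigma_funE; exact: config_mean_sigma.
  have mm := config_mean_sigma o2 pp2.
  have ma : sigma_fun X (J p) (fun w => config_mean p2 o2 w + s w).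
    by apply/sigma_funE; apply: measurable_funD; exact/sigma_funE.
  have mb : sigma_fun X (J p) (fun w => config_mean p2 o2 w - s w).
    by apply/sigma_funE; apply: measurable_funB; exact/sigma_funE.
  apply: filterS2 (config_neq n ma) (config_neq n mb) => w na nb _ _ _.
  apply/eqP => e; have : `|M p n.+1 w - config_mean p2 o2 w| = s w.
    by rewrite /s -e divfK ?gt_eqF// sqrtr_sqr.
  case: (ger0P (M p n.+1 w - config_mean p2 o2 w)) => _ e'.
    by apply: na; rewrite -e'; ring.
  by apply: nb; rewrite -e'; ring.
apply: filterS2 h1 h2 => w g1 g2; split=> [p n p' o|p n p2 p3 p4 o2 o3 o4].
  exact: (g1 (p, n, p', o)).
exact: (g2 (p, n, p2, p3, p4, o2, o3, o4)).
Qed.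
End Generic.

(** * A single trajectory *)

(* One trajectory.  [M p j] and [V p j] are the posterior mean and variance of
   [p] after [j] replications, [tp t] is the set of the pairs selected at time
   [t], and [None] is the count of a pair that is sampled infinitely often. *)
Section Trajectory.
Context (R : realType) (D : finType) (C : eqType) (ctx : D -> C).
Variables (M V : D -> nat -> R) (ym : D -> R).
Variables (a : nat -> D) (n : nat -> D -> nat) (tp : nat -> {set D}) (t0 : nat).

Let lmean p o := if o is Some j then M p j else ym p.
Let lvar p o := if o is Some j then V p j else 0.

Hypothesis V_gt0 : forall p j, (0 < j)%N -> 0 < V p j.
Hypothesis V_lt : forall p i j, (0 < i)%N -> (i < j)%N -> V p j < V p i.
Hypothesis V_cvg : forall p, V p j @[j --> \oo] --> 0.
Hypothesis M_cvg : forall p, M p j @[j --> \oo] --> ym p.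
Hypothesis genM : forall p j p' o, p' != p -> M p j.+1 != lmean p' o.
Hypothesis genT : forall p j p2 p3 p4 o2 o3 o4, p2 != p -> p3 != p -> p4 != p ->
  (M p j.+1 - lmean p2 o2) ^+ 2 / (V p j.+1 + lvar p2 o2) !=
  (lmean p3 o3 - lmean p4 o4) ^+ 2 / (lvar p3 o3 + lvar p4 o4).

Hypothesis nS : forall t p, n t.+1 p = (n t p + (a t == p))%N.
Hypothesis n_gt0 : forall p, (0 < n t0 p)%N.

(** [hr] is the pair granted one hypothetical extra replication; [None] is the current state. *)
Definition term (hr : option D) t P Q :=
  (M P (n t P) - M Q (n t Q)) ^+ 2 /
  (V P (n t P + (hr == Some P)) + V Q (n t Q + (hr == Some Q))).

Definition active t P Q := [&& ctx P == ctx Q, P \in tp t & Q \notin tp t].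

Hypothesis tp_up : forall t P Q, (t0 <= t)%N -> active t P Q ->
  M Q (n t Q) <= M P (n t P).
(** This is how the constant size of the selected sets in each context enters. *)
Hypothesis tp_exchange : forall t t' p, (t0 <= t)%N -> (t0 <= t')%N ->
  p \in tp t -> p \notin tp t' -> exists o, [/\ ctx o = ctx p, o \in tp t' & o \notin tp t].
Hypothesis tp_mixed : forall t p, (t0 <= t)%N ->
  exists2 o, ctx o = ctx p & (o \in tp t) != (p \in tp t).
(** A comparison of two minima, written without them: the minimum after [hr] is attained at some
    [P], [Q] and does not exceed the minimum after [a t]. *)
Hypothesis rule : forall t hr, (t0 <= t)%N -> exists P Q, active t P Q /\
  forall P' Q', active t P' Q' -> term (Some hr) t P Q <= term (Some (a t)) t P' Q'.

Lemma count_le t t' p : (t <= t')%N -> (n t p <= n t' p)%N.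
Proof.
move=> /subnKC <-; elim: (t' - t)%N => [|s IH]; first by rewrite addn0.
by rewrite addnS nS (leq_trans IH)// leq_addr.
Qed.

Lemma count_gt0 t p : (t0 <= t)%N -> (0 < n t p)%N.
Proof. by move=> /(count_le p); apply: leq_trans. Qed.

Lemma mean_neq t P Q : (t0 <= t)%N -> P != Q -> M P (n t P) != M Q (n t Q).
Proof.
move=> tt PQ; have := @genM P (n t P).-1 Q (Some (n t Q)).
by rewrite prednK ?count_gt0// eq_sym; apply.
Qed.

Lemma active_neq t P Q : active t P Q -> P != Q.
Proof. by case/and3P => _ Pt; apply: contraNneq => <-. Qed.

(** A selected pair never equals an unselected one, so the first of two distinct terms contains a
    pair foreign to the second, as [genT] demands. *)
Lemma active_other t P Q P' Q' : active t P Q -> active t P' Q' ->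
  (P, Q) != (P', Q') -> (P != P') && (P != Q') || (Q != P') && (Q != Q').
Proof.
move=> /and3P[_ Pt Qt] /and3P[_ P't Q't].
have -> : P != Q' by apply: contraNneq Q't => <-.
have -> : Q != P' by apply: contraNneq Qt => ->.
by rewrite xpair_eqE negb_and andbT.
Qed.

Lemma ratioC (x y v w : R) : (x - y) ^+ 2 / (v + w) = (y - x) ^+ 2 / (w + v).
Proof. by rewrite -sqrrN opprB [w + v]addrC. Qed.

Lemma term_neq t P Q P' Q' : (t0 <= t)%N -> active t P Q -> active t P' Q' ->
  (P, Q) != (P', Q') -> term None t P Q != term None t P' Q'.
Proof.
move=> tt aPQ aPQ' ne; have PQ := active_neq aPQ.
rewrite /term !addn0; have /orP[/andP[n1 n2]|/andP[n1 n2]] := active_other aPQ aPQ' ne.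
  have := @genT P (n t P).-1 Q P' Q' (Some (n t Q)) (Some (n t P')) (Some (n t Q')).
  by rewrite prednK ?count_gt0//; apply; rewrite eq_sym.
rewrite ratioC.
have := @genT Q (n t Q).-1 P P' Q' (Some (n t P)) (Some (n t P')) (Some (n t Q')).
by rewrite prednK ?count_gt0//; apply; rewrite // eq_sym.
Qed.

Lemma V_le_add p j b : (0 < j)%N -> V p (j + b) <= V p j.
Proof.
case: b => [|b] j0; first by rewrite addn0.
by apply/ltW/V_lt => //; rewrite addnS ltnS leq_addr.
Qed.

Lemma V_add_gt0 p j b : (0 < j)%N -> 0 < V p (j + b).
Proof. by move=> j0; apply: V_gt0; rewrite addn_gt0 j0. Qed.

Lemma term_ge hr t P Q : (t0 <= t)%N -> term None t P Q <= term hr t P Q.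
Proof.
move=> tt; rewrite /term !addn0; apply: ler_wpM2l; first exact: sqr_ge0.
rewrite lef_pV2 ?posrE ?addr_gt0 ?V_add_gt0 ?V_gt0 ?count_gt0//.
by apply: lerD; apply: V_le_add; exact: count_gt0.
Qed.

Lemma term_gt t P Q hr : (t0 <= t)%N -> P != Q -> (hr == P) || (hr == Q) ->
  term None t P Q < term (Some hr) t P Q.
Proof.
move=> tt PQ h; rewrite /term !addn0 ltr_pM2l; last first.
  by rewrite lt_def sqr_ge0 andbT sqrf_eq0 subr_eq0 mean_neq.
rewrite ltf_pV2 ?posrE ?addr_gt0 ?V_add_gt0 ?V_gt0 ?count_gt0//.
case/orP: h => /eqP <-; rewrite eqxx addn1.
  by apply: ltr_leD; [apply: V_lt|apply: V_le_add]; rewrite ?count_gt0.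
by apply: ler_ltD; [apply: V_le_add|apply: V_lt]; rewrite ?count_gt0.
Qed.

Lemma term_same t P Q hr : hr != P -> hr != Q -> term (Some hr) t P Q = term None t P Q.
Proof.
move=> hP hQ; rewrite /term.
have E x : (Some hr == Some x) = (hr == x) by [].
by rewrite !E (negbTE hP) (negbTE hQ).
Qed.

Definition minimal t P Q :=
  active t P Q /\ forall P' Q', active t P' Q' -> term None t P Q <= term None t P' Q'.

(** By genericity the minimal term is unique. If [a t] were not in it, sampling [a t] would leave
    the minimum as it is, while sampling [P] would raise this term and keep all others strictly
    above the old minimum. *)
Lemma sampled_minimal t : (t0 <= t)%N ->
  exists P Q, minimal t P Q /\ ((a t == P) || (a t == Q)).
Proof.
move=> tt; have [P1 [Q1 [act1 _]]] := rule (a t) tt.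
have act1' : active t (P1, Q1).1 (P1, Q1).2 by [].
have [[P Q] /= actPQ minPQ] :=
  @arg_minP _ _ _ (P1, Q1) (fun e : D * D => active t e.1 e.2) (fun e => term None t e.1 e.2) act1'.
exists P, Q; split; first by split=> // P' Q' act'; exact: (minPQ (P', Q')).
apply: contrapT => /negP; rewrite negb_or => /andP[nP nQ].
have [P2 [Q2 [act2 le2]]] := rule P tt.
have := le2 _ _ actPQ; rewrite (term_same _ nP nQ) => h.
have le21 : term None t P2 Q2 <= term None t P Q by apply: le_trans h; exact: term_ge.
have [e|ne] := eqVneq (P2, Q2) (P, Q).
  move: h; case: e => -> ->; rewrite leNgt => /negP; apply.
  by apply: term_gt; rewrite ?eqxx//; exact: active_neq actPQ.
have := term_neq tt act2 actPQ ne; rewrite eq_le le21 /=.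
by rewrite (minPQ (P2, Q2) act2).
Qed.

(** * Final counts and limits of the terms *)

Variable c : D -> option nat.
Hypothesis c_Some : forall p j, c p = Some j -> \forall t \near \oo, n t p = j.
Hypothesis c_None : forall p, c p = None -> n t p @[t --> \oo] --> \oo.

Let lm p := lmean p (c p).
Let lv (hr : option D) p := if c p is Some j then V p (j + (hr == Some p)) else 0.

(** For two pairs of infinite count this divides by 0; limits are therefore compared only for
    [frozen] terms, whose denominator stays positive. *)
Definition limit_term hr P Q := (lm P - lm Q) ^+ 2 / (lv hr P + lv hr Q).

Lemma final_count_gt0 p j : c p = Some j -> (0 < j)%N.
Proof.
move=> /c_Some cj; have [t [<- tt]] : exists t, n t p = j /\ (t0 <= t)%N.
  near \oo => t; exists t; split; near: t; last exact: nbhs_infty_ge.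
  exact: cj.
exact: count_gt0.
Unshelve. all: by end_near.
Qed.

Lemma mean_cvg p : M p (n t p) @[t --> \oo] --> lm p.
Proof.
rewrite /lm /lmean; case e: (c p) => [j|].
  apply: cvg_near_cst; apply: filterS (c_Some e) => t -> //.
by apply: cvg_comp (c_None e) _; exact: M_cvg.
Qed.

Lemma var_cvg hr p : V p (n t p + (hr == Some p)) @[t --> \oo] --> lv hr p.
Proof.
rewrite /lv; case e: (c p) => [j|].
  apply: cvg_near_cst; apply: filterS (c_Some e) => t -> //.
apply: (@cvg_comp _ _ _ (fun t => (n t p + (hr == Some p))%N) (V p)); last exact: V_cvg.
case: (hr == Some p); last by under eq_fun do rewrite addn0; exact: c_None.
under eq_fun do rewrite addn1.
move=> A [N _ hN]; have := c_None e; move=> /(_ [set i | (N <= i)%N]).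
case; first by exists N.
move=> N' _ hN'; exists N' => // t /hN' /= Nn; apply: hN => /=.
exact: leq_trans Nn _.
Qed.

Lemma lv_ge0 hr p : 0 <= lv hr p.
Proof.
rewrite /lv; case e: (c p) => [j|] //.
by apply/ltW/V_add_gt0; exact: final_count_gt0 e.
Qed.

Lemma lv_gt0 hr p : c p != None -> 0 < lv hr p.
Proof.
rewrite /lv; case e: (c p) => [j|] // _.
by apply/V_add_gt0; exact: final_count_gt0 e.
Qed.

Definition frozen P Q := (c P != None) || (c Q != None).

Lemma lv_sum_gt0 hr P Q : frozen P Q -> 0 < lv hr P + lv hr Q.
Proof.
case/orP => h; first by rewrite ltr_pwDl ?lv_gt0 ?lv_ge0.
by rewrite ltr_wpDl ?lv_gt0 ?lv_ge0.
Qed.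

Lemma term_cvg hr P Q : frozen P Q -> term hr t P Q @[t --> \oo] --> limit_term hr P Q.
Proof.
move=> fPQ; apply: cvgM.
  apply: (cvg_comp (fun t => M P (n t P) - M Q (n t Q)) (fun x => x ^+ 2)).
    by apply: cvgB; exact: mean_cvg.
  exact: exprn_continuous.
apply: cvgV; first by rewrite gt_eqF// lv_sum_gt0.
by apply: cvgD; exact: var_cvg.
Qed.

Lemma near_lt (f g : nat -> R) (x y : R) : f t @[t --> \oo] --> x -> g t @[t --> \oo] --> y ->
  x < y -> \forall t \near \oo, f t < g t.
Proof.
move=> fx gy xy; have xm : x < (x + y) / 2 by lra.
have my : (x + y) / 2 < y by lra.
have h1 := cvgr_lt x fx _ xm.
have h2 := cvgr_gt y gy _ my.
near=> t; apply: (@lt_trans _ _ ((x + y) / 2)); near: t; [exact: h1|exact: h2].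
Unshelve. all: by end_near.
Qed.

Lemma terms_ordered : \forall t \near \oo, forall hr P Q hr' P' Q',
  frozen P Q -> frozen P' Q' -> limit_term hr P Q < limit_term hr' P' Q' ->
  term hr t P Q < term hr' t P' Q'.
Proof.
(* Packing the arguments into one finite type lets [filter_forall] provide a common time. *)
suff : \forall t \near \oo, forall x : option D * D * D * option D * D * D,
    let '(hr, P, Q, hr', P', Q') := x in
  frozen P Q -> frozen P' Q' -> limit_term hr P Q < limit_term hr' P' Q' ->
  term hr t P Q < term hr' t P' Q'.
  by apply: filterS => t h hr P Q hr' P' Q'; exact: (h (hr, P, Q, hr', P', Q')).
apply: filter_forall => -[[[[[hr P] Q] hr'] P'] Q'].
have [f1|_] := boolP (frozen P Q); last by apply: nearW => t.
have [f2|_] := boolP (frozen P' Q'); last by apply: nearW => t _.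
have [lt|_] := boolP (limit_term hr P Q < limit_term hr' P' Q'); last first.
  by apply: nearW => t _ _.
have := near_lt (@term_cvg hr _ _ f1) (@term_cvg hr' _ _ f2) lt.
by apply: filterS.
Qed.

Lemma means_ordered : \forall t \near \oo, forall P Q, lm P < lm Q ->
  M P (n t P) < M Q (n t Q).
Proof.
suff : \forall t \near \oo, forall x : D * D, lm x.1 < lm x.2 ->
    M x.1 (n t x.1) < M x.2 (n t x.2).
  by apply: filterS => t h P Q; exact: (h (P, Q)).
apply: filter_forall => -[P Q] /=.
have [lt|_] := boolP (lm P < lm Q); last by apply: nearW => t.
have := near_lt (@mean_cvg P) (@mean_cvg Q) lt.
by apply: filterS.
Qed.

Lemma term_bound : exists2 K, 0 < K & \forall t \near \oo, forall hr P Q, frozen P Q ->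
  term hr t P Q < K.
Proof.
pose K := 1 + \sum_(x : option D * D * D) `|limit_term x.1.1 x.1.2 x.2|.
have K0 : 0 < K by rewrite ltr_pwDl ?sumr_ge0.
exists K => //.
suff : \forall t \near \oo, forall x : option D * D * D,
    frozen x.1.2 x.2 -> term x.1.1 t x.1.2 x.2 < K.
  by apply: filterS => t h hr P Q; exact: (h (hr, P, Q)).
apply: filter_forall => x.
have [f|_] := boolP (frozen x.1.2 x.2); last by apply: nearW => t.
have /(near_lt (@term_cvg x.1.1 _ _ f) (cvg_cst K)) : limit_term x.1.1 x.1.2 x.2 < K; last first.
  by apply: filterS.
rewrite /K (bigD1 x)//= addrCA ltr_pwDr//; last exact: ler_norm.
by rewrite ltr_pwDl ?sumr_ge0.
Qed.

Lemma untied_term K : \forall t \near \oo, forall P Q, c P = None -> c Q = None ->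
  ym P != ym Q -> K <= term None t P Q.
Proof.
suff : \forall t \near \oo, forall x : D * D, c x.1 = None -> c x.2 = None ->
    ym x.1 != ym x.2 -> K <= term None t x.1 x.2.
  by apply: filterS => t h P Q; exact: (h (P, Q)).
apply: filter_forall => -[P Q] /=.
case cP: (c P) => [?|]; first exact: nearW.
case cQ: (c Q) => [?|]; first exact: nearW.
have [_|ne] := eqVneq (ym P) (ym Q); first exact: nearW.
have c1 : K * (V P (n t P + 0) + V Q (n t Q + 0)) @[t --> \oo] --> K * (0 + 0).
  apply: cvgM; first exact: cvg_cst.
  apply: cvgD.
    have := @var_cvg None P; rewrite /lv cP; exact.
  have := @var_cvg None Q; rewrite /lv cQ; exact.
have c2 : (M P (n t P) - M Q (n t Q)) ^+ 2 @[t --> \oo] --> (ym P - ym Q) ^+ 2.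
  apply: (cvg_comp (fun t => M P (n t P) - M Q (n t Q)) (fun x => x ^+ 2)).
    apply: cvgB.
      have := @mean_cvg P; rewrite /lm cP; exact.
    have := @mean_cvg Q; rewrite /lm cQ; exact.
  exact: exprn_continuous.
have lt : K * (0 + 0) < (ym P - ym Q) ^+ 2.
  by rewrite addr0 mulr0 lt_def sqr_ge0 andbT sqrf_eq0 subr_eq0.
apply: filterS2 (near_lt c1 c2 lt) (nbhs_infty_ge t0) => t h /= tt _ _ _.
by rewrite /term ler_pdivlMr ?ltW// addr_gt0 ?V_add_gt0 ?count_gt0.
Qed.

Lemma limit_term_same p P Q : c p = None -> limit_term (Some p) P Q = limit_term None P Q.
Proof.
move=> cp; rewrite /limit_term /lv.
suff E x : (if c x is Some j then V x (j + (Some p == Some x)) else 0) =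
         (if c x is Some j then V x (j + (None == Some x)) else 0) by rewrite !E.
case e: (c x) => [j|//]; have -> // : (Some p == Some x) = false.
by apply/negP => /eqP[px]; rewrite px e in cp.
Qed.

Lemma limit_term_notin p P Q : p != P -> p != Q -> limit_term (Some p) P Q = limit_term None P Q.
Proof.
move=> pP pQ; rewrite /limit_term /lv.
have E x : (Some p == Some x) = (p == x) by [].
by rewrite !E (negbTE pP) (negbTE pQ).
Qed.

Lemma final_mean_neq P Q : P != Q -> c P != None -> lm P != lm Q.
Proof.
move=> PQ; case e: (c P) => [j|//] _; have := @genM P j.-1 Q (c Q).
rewrite prednK ?(final_count_gt0 e)// eq_sym => /(_ PQ).
by rewrite /lm e.
Qed.

Lemma limit_term_gt f P Q : P != Q -> c f != None -> (f == P) || (f == Q) ->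
  limit_term None P Q < limit_term (Some f) P Q.
Proof.
move=> PQ cf fPQ; have fr : frozen P Q.
  by rewrite /frozen; case/orP: fPQ => /eqP <-; rewrite cf ?orbT.
have mPQ : lm P != lm Q.
  case/orP: fPQ => /eqP e; subst f; first exact: final_mean_neq.
  rewrite eq_sym; apply: final_mean_neq => //; first by rewrite eq_sym.
rewrite /limit_term ltr_pM2l; last by rewrite lt_def sqr_ge0 andbT sqrf_eq0 subr_eq0.
rewrite ltf_pV2 ?posrE ?lv_sum_gt0//.
have le x : lv (Some f) x <= lv None x.
  rewrite /lv; case e: (c x) => [j|//]; rewrite addn0.
  by apply: V_le_add; exact: final_count_gt0 e.
have lt : lv (Some f) f < lv None f.
  rewrite /lv; case e: (c f) cf => [j|//] _; rewrite eqxx addn0 addn1.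
  by apply: V_lt => //; exact: final_count_gt0 e.
by case/orP: fPQ => /eqP <-; [apply: ltr_leD|apply: ler_ltD].
Qed.

(** Genericity reaches the limit configuration since [genT] admits infinite counts; the finite count
    of [f] supplies the randomness. *)
Lemma limit_term_neq f P Q P' Q' : P != Q -> c f != None -> (f == P) || (f == Q) ->
  f != P' -> f != Q' -> limit_term None P Q != limit_term None P' Q'.
Proof.
have lvE x : lv None x = lvar x (c x).
  by rewrite /lv /lvar; case: (c x) => [j|//]; rewrite addn0.
move=> PQ; case e: (c f) => [j|//] _ fPQ fP' fQ'.
rewrite /limit_term !lvE; case/orP: fPQ => /eqP ef; [|rewrite ratioC]; subst f.
  have := @genT P j.-1 Q P' Q' (c Q) (c P') (c Q').
  rewrite prednK ?(final_count_gt0 e)// /lm e /=.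
  by apply; rewrite // eq_sym.
have := @genT Q j.-1 P P' Q' (c P) (c P') (c Q').
rewrite prednK ?(final_count_gt0 e)// /lm e /=.
by apply; rewrite // eq_sym.
Qed.

Definition ordered_at t := forall hr P Q hr' P' Q',
  frozen P Q -> frozen P' Q' -> limit_term hr P Q < limit_term hr' P' Q' ->
  term hr t P Q < term hr' t P' Q'.

Lemma limit_le t P Q P' Q' : ordered_at t -> frozen P Q -> frozen P' Q' ->
  term None t P Q <= term None t P' Q' -> limit_term None P Q <= limit_term None P' Q'.
Proof.
move=> ot f1 f2 le; rewrite leNgt; apply/negP => lt.
by have := ot _ _ _ _ _ _ f2 f1 lt; rewrite ltNge le.
Qed.

(* Sampling [a t] instead of the frozen pair [f] of the minimal term can only
   be optimal if another term, without frozen pairs, is about as small. *)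
Lemma unfrozen_term_small t P Q f : (t0 <= t)%N -> ordered_at t -> c (a t) = None ->
  minimal t P Q -> c f != None -> (f == P) || (f == Q) -> (a t == P) || (a t == Q) ->
  exists P' Q', [/\ active t P' Q', c P' = None, c Q' = None &
    term None t P' Q' <= term (Some (a t)) t P Q].
Proof.
move=> tt ot ca [act min] cf fPQ aPQ.
have [P' [Q' [act' le']]] := rule f tt; exists P', Q'.
have le := le' _ _ act.
have PQ := active_neq act; have PQ' := active_neq act'.
have fr : frozen P Q.
  by rewrite /frozen; case/orP: fPQ => /eqP <-; rewrite cf ?orbT.
have [fr'|nfr] := boolP (frozen P' Q'); last first.
  move: nfr; rewrite /frozen negb_or !negbK => /andP[/eqP cP' /eqP cQ'].
  by split=> //; apply: le_trans le; exact: term_ge.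
(* In the limit a replication of [a t], whose count is infinite, changes nothing, whereas one of [f]
   strictly raises the terms with [f]; a frozen term without [f] is already strictly larger by
   genericity. Either way a frozen term of [P'] and [Q'] contradicts [le]. *)
exfalso; have Lmin := limit_le ot fr fr' (min _ _ act').
have : limit_term (Some (a t)) P Q < limit_term (Some f) P' Q'.
  rewrite limit_term_same//; have [ff|] := boolP ((f == P') || (f == Q')).
    by apply: le_lt_trans Lmin _; exact: limit_term_gt.
  rewrite negb_or => /andP[fP' fQ']; rewrite limit_term_notin// lt_neqAle Lmin andbT.
  exact: limit_term_neq fPQ fP' fQ'.
by move=> /(ot _ _ _ _ _ _ fr fr'); rewrite ltNge le.
Qed.

(** * Tied pairs at the selection boundary *)

Section Tied.
Variables (K : R) (s : nat) (P0 Q0 : D).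
Hypothesis s_ge : (t0 <= s)%N.
Hypothesis s_ordered : forall P Q, lm P < lm Q -> M P (n s P) < M Q (n s Q).
Hypothesis s_active : active s P0 Q0.
Hypotheses (cP0 : c P0 = None) (cQ0 : c Q0 = None) (yPQ0 : ym Q0 = ym P0).
Hypothesis K_gt0 : 0 < K.

Definition tied p := [&& ctx p == ctx P0, c p == None & ym p == ym P0].

Lemma tied_ctx p : tied p -> ctx p = ctx P0. Proof. by case/and3P => /eqP. Qed.
Lemma tied_None p : tied p -> c p = None. Proof. by case/and3P => _ /eqP. Qed.
Lemma tied_ym p : tied p -> ym p = ym P0. Proof. by case/and3P => _ _ /eqP. Qed.

Lemma tied_lm p : tied p -> lm p = ym P0.
Proof. by move=> tp'; rewrite /lm /lmean (tied_None tp') (tied_ym tp'). Qed.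

Lemma lm_untied o : ctx o = ctx P0 -> ~~ tied o -> lm o != ym P0.
Proof.
move=> co no; case e: (c o) => [j|].
  have := @final_mean_neq o P0; rewrite e [lm P0]/lm cP0 /=; apply=> //.
  by apply/negP => /eqP oP; rewrite oP cP0 in e.
by rewrite /lm e /=; move: no; rewrite /tied co e !eqxx.
Qed.

(** [P0] is selected and [Q0] is not, both with limit [ym P0]; the selection boundary sits at this
    value and sorts every untied pair of the context. *)
Lemma selected_untied o : ctx o = ctx P0 -> ~~ tied o -> (o \in tp s) = (ym P0 < lm o).
Proof.
move=> co no; have := lm_untied co no; have /and3P[/eqP cPQ P0s Q0s] := s_active.
have lmP : lm P0 = ym P0 by rewrite /lm cP0.
have lmQ : lm Q0 = ym P0 by rewrite /lm cQ0 /= yPQ0.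
rewrite neq_lt => /orP[lt|lt].
  rewrite ltNge (ltW lt) /=; apply/negP => os.
  have act : active s o Q0 by rewrite /active co cPQ eqxx os.
  have := tp_up s_ge act; rewrite leNgt => /negP; apply.
  by apply: s_ordered; rewrite lmQ.
rewrite lt; apply: contrapT => /negP os.
have act : active s P0 o by rewrite /active co eqxx P0s.
have := tp_up s_ge act; rewrite leNgt => /negP; apply.
by apply: s_ordered; rewrite lmP.
Qed.

(* A tied pair outside [A] that ought to be inside has been displaced, by the
   exchange property, by a tied pair that ought to be outside. *)
Lemma side_of_tied (m : D -> R) (A B : {set D}) (th b : R) p :
  (forall x z, ctx x = ctx z -> x \in A -> z \notin A -> m z <= m x) ->
  (forall x, x \in B -> x \notin A -> exists o, [/\ ctx o = ctx x, o \in A & o \notin B]) ->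
  (forall o i, ctx o = ctx P0 -> ~~ tied o -> tied i ->
     if o \in B then m i < m o else m o < m i) ->
  (forall i, tied i -> i \notin B -> m i <= th + b) ->
  tied p -> p \in B -> th + b < m p ->
  p \in A /\ forall z, tied z -> z \notin A -> m z <= th + b.
Proof.
move=> up ex sep low tp' pB mp.
have bound z : tied z -> z \notin A -> m z <= th + b.
  move=> tz zA; have [zB|] := boolP (z \in B); last exact: low.
  have [ o [co oA oB]] := ex _ zB zA; apply: le_trans (up _ _ co oA zA) _.
  have [t_o|no] := boolP (tied o); first exact: low.
  have co' : ctx o = ctx P0 by rewrite co tied_ctx.
  have := sep _ _ co' no tz; rewrite (negbTE oB) ltNge.
  by rewrite (up _ _ co oA zA).
split=> //; apply: contrapT => /negP pA.
by have := bound _ tp' pA; rewrite leNgt mp.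
Qed.

Let sgn (p : D) : R := if p \in tp s then 1 else -1.

(** [p] is at least [2 b] away on its own side. By [side_of_tied], the tied pairs across the
    selection, even displaced ones, are at most [b] away on that side, so the gap is at least [b],
    and [b ^ 2] dominates [K] times the variances. *)
Lemma tied_locked t N b p : (t0 <= t)%N ->
  (forall P Q, lm P < lm Q -> M P (n t P) < M Q (n t Q)) ->
  (forall P Q, c P = None -> c Q = None -> ym P != ym Q -> K <= term None t P Q) ->
  tied p -> (forall o, tied o -> (N <= n t o)%N) -> 0 < b ->
  2 * b <= sgn p * (M p (n t p) - ym p) ->
  (forall o j, (N <= j)%N -> - b <= sgn o * (M o j - ym o)) ->
  (forall x z i j, (N <= i)%N -> (N <= j)%N -> K * (V x i + V z j) <= b ^+ 2) ->
  (p \in tp t) = (p \in tp s) /\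
  forall P Q, active t P Q -> c P = None -> c Q = None -> (p == P) || (p == Q) ->
    K <= term None t P Q.
Proof.
move=> tt ord unt tp' cnt b0 hp low var.
have term_big P Q : tied P -> tied Q -> b <= `|M P (n t P) - M Q (n t Q)| ->
    K <= term None t P Q.
  move=> tP tQ hb; rewrite /term !addn0 ler_pdivlMr; last first.
    by rewrite addr_gt0 ?V_gt0 ?count_gt0.
  apply: le_trans (var _ _ _ _ (cnt _ tP) (cnt _ tQ)) _.
  rewrite -[leRHS]real_normK ?num_real// ler_sqr ?nnegrE//; exact: ltW.
have untied_pair P Q : ctx P = ctx Q -> c P = None -> c Q = None ->
    tied P || tied Q -> tied P && tied Q \/ K <= term None t P Q.
  move=> cPQ cP cQ h; have [e|ne] := eqVneq (ym P) (ym Q); last by right; exact: unt.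
  by left; move: h; rewrite /tied cP cQ e cPQ !eqxx /= orbb andbb.
have sep o i : ctx o = ctx P0 -> ~~ tied o -> tied i ->
    if o \in tp s then M i (n t i) < M o (n t o) else M o (n t o) < M i (n t i).
  move=> co no ti; have := lm_untied co no; rewrite selected_untied//.
  by case: (ltgtP (lm o) (ym P0)) => // lt _; apply: ord; rewrite (tied_lm ti).
have [ps|ps] := boolP (p \in tp s).
  have [pt hz] : p \in tp t /\ forall z, tied z -> z \notin tp t -> M z (n t z) <= ym P0 + b.
    apply: (@side_of_tied (fun x => M x (n t x)) (tp t) (tp s)) => //.
    - by move=> x z cxz xt zt; apply: tp_up => //; rewrite /active cxz eqxx xt zt.
    - by move=> x xs xt; exact: tp_exchange xs xt.
    - move=> i ti iB; have := low i _ (cnt _ ti).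
      by rewrite /sgn (negbTE iB) (tied_ym ti); lra.
    - by move: hp; rewrite /sgn ps (tied_ym tp'); lra.
  split=> // P Q act cP cQ pPQ; have /and3P[/eqP cPQ Pt Qt] := act.
  have pP : p = P.
    by case/orP: pPQ => /eqP e //; rewrite e (negbTE Qt) in pt.
  subst P; have [|/andP[_ tQ]|//] := untied_pair p Q cPQ cP cQ; first by rewrite tp'.
  have := hz _ tQ Qt; move: hp; rewrite /sgn ps (tied_ym tp') => hp hQ.
  by apply: term_big => //; rewrite ger0_norm; lra.
(* An unselected [p] is the mirror image: opposite means and complementary sets. *)
have [pt hz] : p \in ~: tp t /\
    forall z, tied z -> z \notin ~: tp t -> - M z (n t z) <= - ym P0 + b.
  apply: (@side_of_tied (fun x => - M x (n t x)) (~: tp t) (~: tp s)) => //.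
  - move=> x z cxz; rewrite !inE negbK lerN2 => xt zt.
    by apply: tp_up => //; rewrite /active cxz eqxx xt zt.
  - move=> x; rewrite !inE negbK => xs xt; have [ o [co os ot]] := tp_exchange tt s_ge xt xs.
    by exists o; rewrite !inE negbK.
  - move=> o i co no ti; have := sep _ _ co no ti; rewrite inE.
    by case: (o \in tp s); rewrite /= ltrN2.
  - move=> i ti; rewrite inE negbK => iB; have := low i _ (cnt _ ti).
    by rewrite /sgn iB (tied_ym ti); lra.
  - by rewrite inE.
  - by move: hp; rewrite /sgn (negbTE ps) (tied_ym tp'); lra.
rewrite inE in pt; split; first exact: negbTE.
move=> P Q act cP cQ pPQ; have /and3P[/eqP cPQ Pt Qt] := act.
have pQ : p = Q.
  by case/orP: pPQ => /eqP e //; rewrite e Pt in pt.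
subst Q; have [|/andP[tP _]|//] := untied_pair P p cPQ cP cQ; first by rewrite tp' orbT.
have := hz _ tP; rewrite inE negbK => /(_ Pt).
move: hp; rewrite /sgn (negbTE ps) (tied_ym tp') => hp hP.
by apply: term_big => //; rewrite ger0_norm; lra.
Qed.

Lemma sampling_time N t1 p : c p = None -> (n t1 p <= N)%N ->
  exists t, [/\ (t1 <= t)%N, n t p = N & a t = p].
Proof.
move=> cp n1; have ex : exists t, (N < n t.+1 p)%N.
  have [t0' _ h] := c_None cp (nbhs_infty_ge N.+1).
  by exists t0'; apply: h => /=.
case: (ex_minnP ex) => t Nt tmin; exists t.
have le : (n t p <= N)%N.
  case: t Nt tmin => [|t] Nt tmin; first by apply: leq_trans n1; exact: count_le.
  by rewrite leqNgt; apply/negP => /tmin; rewrite ltnn.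
have : (N < n t p + (a t == p))%N by rewrite -nS.
case: eqP => [e|_]; last by rewrite addn0 ltnNge le.
rewrite addn1 ltnS => ge; split=> //; last by apply/eqP; rewrite eqn_leq le.
rewrite leqNgt; apply/negP => lt; have := count_le p lt.
by rewrite leqNgt (leq_ltn_trans n1).
Qed.

(** Put [p = e (x - y)], [q = e (x - x')] and [dl = v - v']. The numerator is multiplied by
    [(1 - q / p) ^ 2], at most [1 - q / p]; and [p <= L w] with [L dl < q] gives [p dl < q w], so
    the numerator shrinks relatively more than the denominator. *)
Lemma ratio_lt (e x x' y v v' w L : R) : e ^+ 2 = 1 -> 0 < w -> 0 < v' -> v' <= v ->
  0 < e * (x - y) -> 0 <= e * (x' - y) -> e * (x - y) <= L * w ->
  L * (v - v') < e * (x - x') ->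
  (x' - y) ^+ 2 / (v' + w) < (x - y) ^+ 2 / (v + w).
Proof.
move=> e1 w0 v0 vv D0 D1 DL Ld.
have -> : (x' - y) ^+ 2 = (e * (x' - y)) ^+ 2 by rewrite exprMn e1 mul1r.
have -> : (x - y) ^+ 2 = (e * (x - y)) ^+ 2 by rewrite exprMn e1 mul1r.
have E : e * (x' - y) = e * (x - y) - e * (x - x') by ring.
rewrite E in D1 *; move: (e * (x - y)) (e * (x - x')) D0 D1 DL Ld => p q p0 pq pL Lq.
rewrite ltr_pdivrMr; last by lra.
rewrite mulrAC ltr_pdivlMr; last by lra.
set dl := v - v' in Lq; have -> : v = v' + dl by rewrite /dl; lra.
have dl0 : 0 <= dl by rewrite /dl; lra.
have L0 : 0 < L by rewrite -(pmulr_lgt0 L w0); lra.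
have q0 : 0 < q by apply: le_lt_trans Lq; rewrite mulr_ge0// ltW.
have h1 : p * dl < w * q.
  apply: (@le_lt_trans _ _ (L * w * dl)); first by rewrite ler_wpM2r.
  by rewrite -mulrA mulrCA ltr_pM2l.
have h2 : (p - q) ^+ 2 <= p ^+ 2 - p * q by nra.
have h3 : (p - q) ^+ 2 * (v' + dl + w) <= (p ^+ 2 - p * q) * (v' + dl + w).
  by rewrite ler_wpM2r//; lra.
apply: le_lt_trans h3 _.
have h4 : 0 < p * (w * q - p * dl) by rewrite mulr_gt0//; lra.
have h5 : 0 <= p * q * v' by rewrite !mulr_ge0//; apply: ltW.
have h6 : 0 <= p * q * dl by rewrite !mulr_ge0//; apply: ltW.
nra.
Qed.

Lemma term_unsampled hr t P Q : a t != P -> a t != Q -> term hr t.+1 P Q = term hr t P Q.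
Proof. by rewrite /term !nS => /negbTE -> /negbTE ->; rewrite !addn0. Qed.

Variables (t1 : nat) (f0 : D) (L : R).
Hypothesis t1_ge : (t0 <= t1)%N.
Hypothesis f0_frozen : c f0 != None.
Hypothesis L_ge : K <= L.
Hypothesis L_bound : forall f j, c f = Some j -> `|ym P0 - lm f| + 1 <= L * V f j.
Hypothesis eventually_frozen : forall t p j, (t1 <= t)%N -> c p = Some j -> n t p = j.
Hypothesis eventually_ordered : forall t, (t1 <= t)%N -> ordered_at t.
Hypothesis eventually_means : forall t, (t1 <= t)%N ->
  forall P Q, lm P < lm Q -> M P (n t P) < M Q (n t Q).
Hypothesis eventually_close : forall t p, (t1 <= t)%N -> `|M p (n t p) - lm p| <= 1.
Hypothesis eventually_untied : forall t, (t1 <= t)%N ->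
  forall P Q, c P = None -> c Q = None -> ym P != ym Q -> K <= term None t P Q.
Hypothesis eventually_small : forall t P Q, (t1 <= t)%N -> frozen P Q -> term None t P Q < K.

Lemma minimal_small t P Q : (t1 <= t)%N -> minimal t P Q -> term None t P Q < K.
Proof.
move=> tt [act min]; have tt0 := leq_trans t1_ge tt.
have [ o co ot] := tp_mixed f0 tt0.
have [f0t|f0t] := boolP (f0 \in tp t).
  apply: le_lt_trans (min f0 o _) _; last by apply: eventually_small; rewrite ?/frozen ?f0_frozen.
  by rewrite /active co eqxx f0t /=; move: ot; rewrite f0t; case: (o \in _).
apply: le_lt_trans (min o f0 _) _; last by apply: eventually_small; rewrite ?/frozen ?f0_frozen ?orbT.
by rewrite /active co eqxx f0t /=; move: ot; rewrite (negbTE f0t); case: (o \in _).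
Qed.

Lemma sampled_None t : (t1 <= t)%N -> c (a t) = None.
Proof.
move=> tt; case e: (c (a t)) => [j|//].
have := eventually_frozen tt e; have := eventually_frozen (leqW tt) e.
by rewrite nS eqxx addn1 => <- /eqP; rewrite ltn_eqF.
Qed.

(* At time [t] the tied pair [p] is sampled, because of a term with a frozen
   pair [f]; its observation brings [p] closer to [f], so that at the next time
   the same term is minimal, and even smaller. *)
Lemma favourable_step t N b p : (t1 <= t)%N -> tied p -> a t = p -> n t p = N ->
  (forall o, tied o -> (N <= n t o)%N) -> 0 < b ->
  (forall j, (N <= j <= N.+1)%N -> 2 * b <= sgn p * (M p j - ym p)) ->
  (forall o j, (N <= j)%N -> - b <= sgn o * (M o j - ym o)) ->
  (forall x z i j, (N <= i)%N -> (N <= j)%N -> L * (V x i + V z j) <= b ^+ 2) ->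
  L * (V p N - V p N.+2) < sgn p * (M p N - M p N.+1) ->
  False.
Proof.
move=> tt tp' ap np cnt b0 hp low var step.
have tt0 := leq_trans t1_ge tt; have ttS : (t1 <= t.+1)%N by apply: leqW.
have ttS0 := leqW tt0.
have npS : n t.+1 p = N.+1 by rewrite nS ap eqxx addn1 np.
have N0 : (0 < N)%N by rewrite -np count_gt0.
have cntS o : tied o -> (N <= n t.+1 o)%N.
  by move=> /cnt h; apply: leq_trans h _; exact: count_le.
have varK x z i j : (N <= i)%N -> (N <= j)%N -> K * (V x i + V z j) <= b ^+ 2.
  move=> Ni Nj; apply: le_trans (var _ _ _ _ Ni Nj); apply: ler_wpM2r => //.
  by rewrite addr_ge0// ltW// V_gt0// (leq_trans N0).
have [sidet bigt] := tied_locked tt0 (eventually_means tt) (eventually_untied tt)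
  tp' cnt b0 (eq_ind_r (fun j => 2 * b <= sgn p * (M p j - ym p))
    (hp N (introT andP (conj (leqnn N) (leqnSn N)))) np) low varK.
have [sideS bigS] := tied_locked ttS0 (eventually_means ttS) (eventually_untied ttS)
  tp' cntS b0 (eq_ind_r (fun j => 2 * b <= sgn p * (M p j - ym p))
    (hp N.+1 (introT andP (conj (leqnSn N) (leqnn N.+1)))) npS) low varK.
(* Only the mean of [p] changes, and [p] stays on its side. An exchange would involve two pairs with
   unchanged means, ordered both ways, hence equal, which genericity excludes. *)
have tpS x : (x \in tp t.+1) = (x \in tp t).
  have main z : z \in tp t -> z \notin tp t.+1 -> False.
    move=> zt zS; have [ o [co oS ot]] := tp_exchange tt0 ttS0 zt zS.
    have zp : a t != z.
      by rewrite ap; apply: contraNneq zS => pz; rewrite -pz sideS -sidet pz.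
    have op : a t != o.
      by rewrite ap; apply: contraNneq ot => po; rewrite -po sidet -sideS po.
    have a1 : active t z o by rewrite /active co eqxx zt ot.
    have a2 : active t.+1 o z by rewrite /active co eqxx oS zS.
    have := mean_neq tt0 (active_neq a1).
    have := tp_up ttS0 a2; rewrite !nS (negbTE zp) (negbTE op) !addn0 => h.
    by rewrite eq_le h (tp_up tt0 a1).
  apply/idP/idP => h; apply: contrapT => /negP h'.
    have [ o [co ot oS]] := tp_exchange ttS0 tt0 h h'.
    exact: main ot oS.
  exact: main h h'.
have actS x z : active t.+1 x z = active t x z by rewrite /active !tpS.
have cp := tied_None tp'.
have [P [Q [minPQ aPQ]]] := sampled_minimal tt0.
have [act min] := minPQ; have PQ := active_neq act.
have small := minimal_small tt minPQ.
have ppq : (p == P) || (p == Q) by rewrite -ap.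
(* The terms of [p] with pairs of infinite count are at least [K], above the minimum, so the partner
   of [p] in the minimal term is frozen. *)
have [f [cf fPQ fp pf]] : exists f, [/\ c f != None, (f == P) || (f == Q), f != p &
    (p == P) && (f == Q) || (p == Q) && (f == P)].
  have nb : ~~ ((c P == None) && (c Q == None)).
    apply/negP => /andP[/eqP cP /eqP cQ].
    by have := bigt _ _ act cP cQ ppq; rewrite leNgt small.
  case/orP: ppq => /eqP e; [exists Q|exists P]; split.
  - by move: nb; rewrite -e cp.
  - by rewrite eqxx orbT.
  - by rewrite e eq_sym.
  - by rewrite e !eqxx.
  - by move: nb; rewrite -e cp eqxx andbT.
  - by rewrite eqxx.
  - by rewrite e.
  - by rewrite e !eqxx orbT.
have nfS : n t.+1 f = n t f by rewrite nS ap eq_sym (negbTE fp) addn0.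
(* The lookahead at [t.+1] already counts [N.+2] replications of [p]; even with that smaller
   variance the term has dropped. *)
have lt : term (Some p) t.+1 P Q < term None t P Q.
  case cfE: (c f) cf => [j|//] _.
  have nf := eventually_frozen tt cfE.
  have Mf : M f (n t f) = lm f by rewrite /lm cfE nf.
  have sgn1 : sgn p ^+ 2 = 1 by rewrite /sgn; case: ifP; rewrite ?sqrrN expr1n.
  have sg t' : (t0 <= t')%N -> active t' P Q -> (p \in tp t') = (p \in tp s) ->
      0 <= sgn p * (M p (n t' p) - M f (n t' f)).
    move=> t'0 act' side; have := tp_up t'0 act'.
    have /and3P[_ Pt Qt] := act'; rewrite /sgn -side.
    case/orP: pf => /andP[/eqP -> /eqP ->]; first by rewrite Pt; lra.
    by rewrite (negbTE Qt); lra.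
  have D0 := sg t tt0 act sidet.
  have D1 : 0 <= sgn p * (M p N.+1 - M f (n t f)).
    by rewrite -npS -nfS; apply: sg; rewrite ?actS.
  have sgn_le x : sgn p * x <= `|x|.
    rewrite /sgn; case: ifP => _; first by rewrite mul1r ler_norm.
    by rewrite mulN1r -(normrN x) ler_norm.
  have -> : term (Some p) t.+1 P Q =
      (M p N.+1 - M f (n t f)) ^+ 2 / (V p N.+2 + V f (n t f)).
    rewrite /term; case/orP: pf => /andP[/eqP e1 /eqP e2]; subst.
      by rewrite eqxx (_ : (Some _ == _) = false) ?addn0 ?addn1 ?npS ?nfS//; apply/negbTE; rewrite eq_sym.
    rewrite ratioC.
    by rewrite eqxx (_ : (Some _ == _) = false) ?addn0 ?addn1 ?npS ?nfS//; apply/negbTE; rewrite eq_sym.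
  have -> : term None t P Q = (M p N - M f (n t f)) ^+ 2 / (V p N + V f (n t f)).
    rewrite /term !addn0; case/orP: pf => /andP[/eqP e1 /eqP e2]; subst; rewrite ?np//.
    by rewrite ratioC.
  apply: (@ratio_lt (sgn p) _ _ _ _ _ _ L) => //.
  - by rewrite V_gt0// count_gt0.
  - by rewrite V_gt0.
  - by apply/ltW/V_lt.
  - rewrite np in D0; rewrite lt_def D0 andbT mulf_eq0 negb_or subr_eq0.
    have -> : M p N != M f (n t f) by rewrite -np mean_neq// eq_sym.
    by rewrite andbT -sqrf_eq0 sgn1 oner_eq0.
  - rewrite nf; apply: le_trans (L_bound cfE); apply: le_trans (sgn_le _) _.
    have -> : M p N - M f j = (ym P0 - lm f) + (M p (n t p) - lm p).
      by rewrite np (tied_lm tp') -Mf nf; ring.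
    by apply: le_trans (ler_normD _ _) _; rewrite lerD2l eventually_close.
have [P' [Q' [minPQ' aPQ']]] := sampled_minimal ttS0.
have [act' min'] := minPQ'; have PQ' := active_neq act'.
have actSPQ : active t.+1 P Q by rewrite actS.
have lt' : term None t.+1 P' Q' < term None t P Q.
  apply: le_lt_trans (min' _ _ actSPQ) _; apply: le_lt_trans lt.
  exact: term_ge.
(* A term without frozen pairs cannot fall below the old minimum: with [p] it is at least [K],
   without [p] it has not changed. *)
have tight x z : active t.+1 x z -> c x = None -> c z = None ->
    term None t.+1 x z < term None t P Q -> False.
  move=> axz cx cz ltxz; have [pxz|] := boolP ((p == x) || (p == z)).
    by have := bigS _ _ axz cx cz pxz; rewrite leNgt (lt_trans ltxz small).
  rewrite negb_or => /andP[px pz]; move: ltxz; rewrite term_unsampled ?ap//.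
  by rewrite ltNge min// -actS.
have pPQ' : (p == P') || (p == Q').
  apply: contrapT => /negP; rewrite negb_or => /andP[px pz].
  move: lt'; rewrite term_unsampled ?ap// ltNge min// -?actS//.
have fr : frozen P Q.
  by rewrite /frozen; case/orP: fPQ => /eqP <-; rewrite cf ?orbT.
have fr' : frozen P' Q'.
  apply: contrapT => /negP; rewrite /frozen negb_or !negbK => /andP[/eqP cP' /eqP cQ'].
  exact: tight act' cP' cQ' lt'.
(* Minimality at [t] and at [t.+1] orders the two limits both ways; if [f] were in the old term
   only, genericity would forbid their equality. *)
have fPQ' : (f == P') || (f == Q').
  apply: contrapT => /negP; rewrite negb_or => /andP[fP' fQ'].
  have := limit_term_neq PQ cf fPQ fP' fQ'; rewrite eq_le.
  rewrite (limit_le (eventually_ordered tt) fr fr') ?min -?actS//.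
  by rewrite (limit_le (eventually_ordered ttS) fr' fr) ?min'.
(* The new minimal term consists of [p] and [f], and [f] is no longer sampled. *)
have aS : a t.+1 = p.
  have cS := sampled_None ttS.
  have other x : x != p -> (x == P') || (x == Q') -> x = if p == P' then Q' else P'.
    move=> xp; case: (eqVneq p P') => [<-|ne]; first by rewrite (negbTE xp) => /eqP.
    by move: pPQ'; rewrite (negbTE ne) => /eqP <-; rewrite (negbTE xp) orbF => /eqP.
  apply/eqP; apply: contrapT => /negP xp.
  by move: cf; rewrite (other f fp fPQ') -(other _ xp aPQ') cS.
have minS : minimal t.+1 P Q.
  split=> // x z axz; suff [-> ->] : P = P' /\ Q = Q' by exact: min'.
  have /and3P[_ Pt Qt] := actSPQ; have /and3P[_ P't Q't] := act'.
  have [PP' QQ'] : (P == P') || (P == Q') /\ (Q == P') || (Q == Q').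
    by case/orP: pf => /andP[/eqP <- /eqP <-].
  split.
    by case/orP: PP' => /eqP // e; rewrite e (negbTE Q't) in Pt.
  by case/orP: QQ' => /eqP // e; rewrite e P't in Qt.
have aSPQ : (a t.+1 == P) || (a t.+1 == Q) by rewrite aS.
have [x [z [axz cx cz]]] :=
  unfrozen_term_small ttS0 (eventually_ordered ttS) (sampled_None ttS) minS cf fPQ aSPQ.
rewrite aS => le; exact: tight axz cx cz (le_lt_trans le lt).
Qed.

End Tied.

(** [B], [L] and [N0] will be read off the trajectory itself, hence the universal quantification for
    one trajectory. *)
Hypothesis favour : forall (B : {set D}) (L : R) (N0 : nat), exists N b,
  let sgn p := if p \in B then 1 else -1 in
  [/\ (N0 <= N)%N /\ 0 < b,
      forall p j, (N <= j <= N.+1)%N -> 2 * b <= sgn p * (M p j - ym p),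
      forall p j, (N <= j)%N -> - b <= sgn p * (M p j - ym p),
      forall p p' j j', (N <= j)%N -> (N <= j')%N -> L * (V p j + V p' j') <= b ^+ 2 &
      forall p, L * (V p N - V p N.+2) < sgn p * (M p N - M p N.+1)].

Lemma means_close : \forall t \near \oo, forall p, `|M p (n t p) - lm p| <= 1.
Proof.
apply: filter_forall => p; have /cvgrPdist_le := @mean_cvg p.
by move=> /(_ 1 ltr01); apply: filterS => t; rewrite distrC.
Qed.

Lemma counts_final : \forall t \near \oo, forall p j, c p = Some j -> n t p = j.
Proof.
suff : \forall t \near \oo, forall p, if c p is Some j then n t p = j else True.
  by apply: filterS => t h p j e; have := h p; rewrite e.
by apply: filter_forall => p; case e: (c p) => [j|]; [exact: c_Some|exact: nearW].
Qed.

Lemma never_frozen p : c p = None.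
Proof.
case cf: (c p) => [j0|//]; exfalso.
have f0 : c p != None by rewrite cf.
have [K K0 small] := term_bound.
have : \forall t \near \oo, [/\ (t0 <= t)%N, ordered_at t /\
   (forall P Q, lm P < lm Q -> M P (n t P) < M Q (n t Q)),
   (forall p, `|M p (n t p) - lm p| <= 1) /\ (forall p j, c p = Some j -> n t p = j),
   (forall P Q, c P = None -> c Q = None -> ym P != ym Q -> K <= term None t P Q) &
   forall hr P Q, frozen P Q -> term hr t P Q < K].
  near=> t; split; [|split|split| |]; near: t.
  - exact: nbhs_infty_ge.
  - exact: terms_ordered.
  - exact: means_ordered.
  - exact: means_close.
  - exact: counts_final.
  - exact: untied_term.
  - exact: small.
case=> t1 _ ev.
have t1_ge : (t0 <= t1)%N by case: (ev t1 (leqnn t1)).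
have e_ord t : (t1 <= t)%N -> ordered_at t by case/ev => _ [].
have e_mean t : (t1 <= t)%N -> forall P Q, lm P < lm Q -> M P (n t P) < M Q (n t Q).
  by case/ev => _ [].
have e_close t x : (t1 <= t)%N -> `|M x (n t x) - lm x| <= 1 by case/ev => _ _ [].
have e_count t x j : (t1 <= t)%N -> c x = Some j -> n t x = j.
  by case/ev => _ _ [_ h] _ _; exact: h.
have e_untied t : (t1 <= t)%N -> forall P Q, c P = None -> c Q = None -> ym P != ym Q ->
    K <= term None t P Q by case/ev.
have e_small t hr P Q : (t1 <= t)%N -> frozen P Q -> term hr t P Q < K.
  by case/ev => _ _ _ _; exact.
have [P0 [Q0 [act0 cP0 cQ0 le0]]] : exists P Q, [/\ active t1 P Q, c P = None, c Q = None &
    term None t1 P Q < K].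
  have [P [Q [minPQ aPQ]]] := sampled_minimal t1_ge.
  have lt := minimal_small t1_ge f0 (fun t P Q tt => @e_small t None P Q tt) (leqnn t1) minPQ.
  have [act _] := minPQ.
  have [fr|] := boolP (frozen P Q); last first.
    by rewrite /frozen negb_or !negbK => /andP[/eqP cP /eqP cQ]; exists P, Q.
  have [f cff fPQ] : exists2 f, c f != None & (f == P) || (f == Q).
    by case/orP: fr => h; [exists P|exists Q]; rewrite ?eqxx ?orbT.
  have ca := sampled_None (fun t x j => @e_count t x j) (leqnn t1).
  have [P' [Q' [act' cP' cQ' le]]] :=
    unfrozen_term_small t1_ge (e_ord _ (leqnn t1)) ca minPQ cff fPQ aPQ.
  by exists P', Q'; split=> //; apply: le_lt_trans le _; exact: e_small.
have yPQ : ym Q0 = ym P0.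
  apply/eqP; rewrite eq_sym; apply: contrapT => /negP ne.
  by have := e_untied _ (leqnn t1) _ _ cP0 cQ0 ne; rewrite leNgt le0.
(* The least factor that [f] requires in [Lb]; the sum of these and [K] serves all frozen pairs. *)
pose w f := if c f is Some j then (`|ym P0 - lm f| + 1) / V f j else 0.
have w0 f : 0 <= w f.
  rewrite /w; case e: (c f) => [j|//]; rewrite divr_ge0 ?addr_ge0//.
  by apply/ltW/V_gt0; exact: final_count_gt0 e.
pose L := K + \sum_f w f.
have LK : K <= L by rewrite lerDl sumr_ge0.
have Lb f j : c f = Some j -> `|ym P0 - lm f| + 1 <= L * V f j.
  move=> e; have Vf : 0 < V f j by apply: V_gt0; exact: final_count_gt0 e.
  have -> : `|ym P0 - lm f| + 1 = w f * V f j by rewrite /w e divfK// gt_eqF.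
  rewrite ler_pM2r// /L (bigD1 f)//= addrCA lerDl addr_ge0 ?sumr_ge0//; exact: ltW.
have [N [b [[N0 b0] hp low var step]]] := favour (tp t1) L (\max_p n t1 p).
have n1 x : (n t1 x <= N)%N by apply: leq_trans N0; exact: leq_bigmax.
have /choice[tau htau] : forall x, exists t, c x = None -> [/\ (t1 <= t)%N, n t x = N & a t = x].
  move=> x; case e: (c x) => [?|]; first by exists 0%N.
  by have [t ht] := sampling_time e (n1 x); exists t.
have tied0 : tied P0 P0 by rewrite /tied cP0 !eqxx.
(* [tau x] is the time at which [x] receives replication [N + 1]; at the latest of these times every
   tied pair has at least [N]. *)
case: (@arg_maxnP _ P0 (tied P0) tau tied0) => x tx xmax.
have [tt nx ax] := htau x (tied_None tx).
have cnt o : tied P0 o -> (N <= n (tau x) o)%N.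
  move=> to'; have [_ no _] := htau o (tied_None to').
  by rewrite -{1}no; apply: count_le; exact: xmax.
refine (@favourable_step K t1 P0 Q0 t1_ge (e_mean _ (leqnn t1)) act0 cP0 cQ0 yPQ
  t1 p L t1_ge f0 LK Lb (fun t x j => @e_count t x j) e_ord e_mean (fun t x => @e_close t x)
  e_untied (fun t P Q tt => @e_small t None P Q tt) (tau x) N b x tt tx ax nx cnt b0
  (hp x) low var (step x)).
Unshelve. all: by end_near.
Qed.

(* Sets of the same size that are both upward closed for the eventual order of
   the posterior means coincide. *)
Lemma selection_cvg (B : {set D}) :
  (forall P Q, ctx P = ctx Q -> P \in B -> Q \notin B -> ym Q < ym P) ->
  (forall t p, (t0 <= t)%N -> p \in tp t -> p \notin B ->
     exists o, [/\ ctx o = ctx p, o \in B & o \notin tp t]) ->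
  (forall t p, (t0 <= t)%N -> p \in B -> p \notin tp t ->
     exists o, [/\ ctx o = ctx p, o \in tp t & o \notin B]) ->
  \forall t \near \oo, tp t = B.
Proof.
move=> Bgap ex1 ex2; have lmE x : lm x = ym x by rewrite /lm never_frozen.
apply: filterS2 means_ordered (nbhs_infty_ge t0) => t ord /= tt.
have no x z : ctx x = ctx z -> x \in tp t -> z \notin tp t -> z \in B -> x \notin B -> False.
  move=> cxz xt zt zB xB; have := Bgap _ _ (esym cxz) zB xB.
  rewrite -!lmE => /ord; rewrite ltNge => /negP; apply.
  by apply: tp_up => //; rewrite /active cxz eqxx xt zt.
apply/setP => x; apply/idP/idP => h; apply: contrapT => /negP h'.
  by have [ o [co oB ot]] := ex1 _ _ tt h h'; apply: (no x o).
by have [ o [co ot oB]] := ex2 _ _ tt h h'; apply: (no o x).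
Qed.

End Trajectory.

(** * Consistency *)

Lemma post_mean_dev (R : realType) (sd pmean ym : R) (psd : \bar R) (y : nat -> R) (n : nat) :
  0 < sd -> (0 < psd)%E -> (0 < n)%N ->
  let c := prior_precision psd * sd ^+ 2 in
  post_mean sd pmean psd y n - ym =
  (c * (pmean - ym) + sd * \sum_(h < n) (y h - ym) / sd) / (c + n%:R).
Proof.
move=> sd0 psd0 n0 c; have c0 := prior_weight_ge0 sd psd0.
have nR : 0 < n%:R :> R by rewrite ltr0n.
rewrite post_meanE//= -/c -mulr_suml mulrCA divff ?gt_eqF// mulr1 sumrB sumr_const card_ord.
by rewrite -[ym *+ n]mulr_natl; field; rewrite gt_eqF//; rewrite -/c in c0; lra.
Qed.

(** [X] is prior weight plus count, and [A / X] the signed deviation of the posterior mean. Two more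
    replications lower the variance by [2 s ^ 2 / (X (X + 2))], one observation with [z <= - 1]
    lowers the deviation by at least [s / (X + 1)]; [2 L s <= X] makes the latter win. *)
Lemma post_step_lt (R : realType) (L s X A z : R) : 0 < s -> 0 < X -> 0 <= A ->
  0 < L -> 2 * L * s <= X -> z <= - 1 ->
  L * (s ^+ 2 / X - s ^+ 2 / (X + 2)) < A / X - (A + s * z) / (X + 1).
Proof.
move=> s0 X0 A0 L0 XL z1; have zN : s * z <= - s by rewrite -mulrN1 ler_pM2l.
apply: (@lt_le_trans _ _ (s / (X + 1))).
  have -> : L * (s ^+ 2 / X - s ^+ 2 / (X + 2)) = s * (2 * L * s / (X * (X + 2))).
    by field; rewrite !gt_eqF//; lra.
  rewrite ltr_pM2l// -[ltRHS]mul1r ltr_pdivrMr ?mulr_gt0//; last by lra.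
  rewrite mul1r [ltRHS]mulrC ltr_pdivlMr; last by lra.
  by nra.
have -> : A / X - (A + s * z) / (X + 1) = (A / X - s * z) / (X + 1).
  by field; rewrite !gt_eqF//; lra.
rewrite ler_pM2r ?invr_gt0; last by lra.
have : 0 <= A / X by rewrite divr_ge0// ltW.
by lra.
Qed.

(** * From standardized walks to posterior means *)

Section FavourablePosterior.
Context (R : realType) (D : finType).
Variables (sd pmean ymean : D -> R) (psd : D -> \bar R) (y : nat -> D -> R).
Hypothesis sd_gt0 : forall p, 0 < sd p.
Hypothesis psd_gt0 : forall p, (0 < psd p)%E.
Variables (u U k0 : R) (sgn : D -> R).
Hypotheses (u_gt0 : 0 < u) (u_le : forall p, u <= sd p) (U_ge : forall p, sd p <= U).
Hypothesis sgn1 : forall p, sgn p ^+ 2 = 1.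

Let M p n := post_mean (sd p) (pmean p) (psd p) (y^~ p) n.
Let V p n := post_var (sd p) (psd p) n.
Let z h p := sgn p * ((y h p - ymean p) / sd p).

Hypothesis fav : forall k : nat, k0 <= k%:R -> forall n0 : nat, exists2 a : nat, (n0 <= a)%N &
  forall p, [/\ z (a ^ 2)%N p <= - 1,
    2 * k%:R * a%:R <= \sum_(h < a ^ 2) z h p,
    2 * k%:R * a%:R <= \sum_(h < (a ^ 2).+1) z h p &
    forall n, (a ^ 2 <= n)%N ->
      - (k%:R / (12 * U / u) * (n%:R / a%:R)) <= \sum_(h < n) z h p].

Let c p := prior_precision (psd p) * sd p ^+ 2.
Let c_ge0 p : 0 <= c p. Proof. exact: prior_weight_ge0. Qed.

Let devE p n : (0 < n)%N -> sgn p * (M p n - ymean p) =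
  (sgn p * (c p * (pmean p - ymean p)) + sd p * \sum_(h < n) z h p) / (c p + n%:R).
Proof.
move=> n0; rewrite /M post_mean_dev// mulrA mulrDr; congr ((_ + _) / _).
by rewrite /z -mulr_sumr mulrCA.
Qed.

Lemma favourable_posterior (L : R) (N0 : nat) : exists N b,
  [/\ (N0 <= N)%N /\ 0 < b,
      forall p j, (N <= j <= N.+1)%N -> 2 * b <= sgn p * (M p j - ymean p),
      forall p j, (N <= j)%N -> - b <= sgn p * (M p j - ymean p),
      forall p p' j j', (N <= j)%N -> (N <= j')%N -> L * (V p j + V p' j') <= b ^+ 2 &
      forall p, L * (V p N - V p N.+2) < sgn p * (M p N - M p N.+1)].
Proof.
have [L' L'0 L_le] : exists2 L', 0 < L' & L <= L'.
  by exists (`|L| + 1); rewrite ?ltr_wpDl// (le_trans (ler_norm L))// lerDl.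
have LL' x : 0 <= x -> L * x <= L' * x by move=> x0; exact: ler_wpM2r.
have [k kb] : exists k : nat, `|k0| + `|72 * L' * U ^+ 2 / u ^+ 2| + 1 < k%:R.
  by exists (Num.truncn (`|k0| + `|72 * L' * U ^+ 2 / u ^+ 2| + 1)).+1; exact: truncnS_gt.
have kk0 : k0 <= k%:R by have := ler_norm k0; have := normr_ge0 (72 * L' * U ^+ 2 / u ^+ 2); lra.
have k1 : 1 <= k%:R :> R.
  by have := normr_ge0 k0; have := normr_ge0 (72 * L' * U ^+ 2 / u ^+ 2); lra.
have kL : 72 * L' * U ^+ 2 <= k%:R ^+ 2 * u ^+ 2.
  rewrite -ler_pdivrMr ?exprn_gt0//.
  have := ler_norm (72 * L' * U ^+ 2 / u ^+ 2); have := normr_ge0 k0; nra.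
(* From [a >= C + 2 L' U] follow [c p <= a], a prior shift of at most [u a / 12], and the condition
   of [post_step_lt]. *)
have [C Cterm] : exists C, forall p, `|c p| + 12 / u * `|c p * (pmean p - ymean p)| <= C.
  exists (\sum_p (`|c p| + 12 / u * `|c p * (pmean p - ymean p)|)) => p.
  rewrite (bigD1 p)//= lerDl sumr_ge0// => q _.
  by rewrite addr_ge0// mulr_ge0// divr_ge0// ltW.
have [n1 n1b] : exists n1 : nat, C + `|2 * L' * U| < n1%:R.
  by exists (Num.truncn (C + `|2 * L' * U|)).+1; exact: truncnS_gt.
have [a na ha] := fav kk0 (N0 + n1 + 2).
have [aN0 an1 a1] : [/\ (N0 <= a ^ 2)%N, (n1 <= a)%N & (1 < a)%N].
  by move: na; clear => na; split; nia.
have aR : C + `|2 * L' * U| <= a%:R.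
  by apply: le_trans (ltW n1b) _; rewrite ler_nat.
have a2 : 2 <= a%:R :> R by rewrite ler_nat.
have a0 : 0 < a%:R :> R by rewrite ltr0n ltnW.
have NR : (a ^ 2)%:R = a%:R ^+ 2 :> R by rewrite natrX.
have N_gt0 : (0 < a ^ 2)%N by rewrite expn_gt0 ltnW.
have asq : a%:R + 1 <= a%:R ^+ 2 :> R by rewrite -natrX natr1 ler_nat expnS expn1 ltn_Pmull// ltnW.
have cp_le p : c p <= a%:R.
  have h1 := Cterm p; have h2 := ler_norm (c p).
  have : 0 <= 12 / u * `|c p * (pmean p - ymean p)| by rewrite mulr_ge0// divr_ge0// ltW.
  have := normr_ge0 (2 * L' * U); lra.
have prior_le p : - (u * a%:R / 12) <= sgn p * (c p * (pmean p - ymean p)).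
  have h1 := Cterm p; set x := c p * _ in h1 *.
  have h2 : 12 / u * `|x| <= a%:R.
    by have := normr_ge0 (c p); have := normr_ge0 (2 * L' * U); lra.
  have h3 : `|x| <= u * a%:R / 12.
    have -> : `|x| = (12 / u * `|x|) * (u / 12) by field; rewrite gt_eqF.
    have -> : u * a%:R / 12 = a%:R * (u / 12) by field.
    by apply: ler_wpM2r => //; rewrite divr_ge0// ltW.
  have : `|sgn p * x| = `|x|.
    rewrite normrM; have -> : `|sgn p| = 1; last by rewrite mul1r.
    by apply/eqP; rewrite -sqrp_eq1// -normrX sgn1 normr1.
  by have := ler_norm (- (sgn p * x)); rewrite normrN; lra.
have [b bE] : exists b, b = k%:R * u / (6 * a%:R) by eexists.
have b0 : 0 < b by rewrite bE; apply: divr_gt0; apply: mulr_gt0 => //; lra.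
have ku : u <= k%:R * u by rewrite ler_peMl// ltW.
exists (a ^ 2)%N, b; split.
- by [].
- move=> p j /andP[Nj jN]; have [h1 h2 h3 h4] := ha p.
  have j1 : (0 < j)%N by exact: leq_trans Nj.
  have S_ge : 2 * k%:R * a%:R <= \sum_(h < j) z h p.
    by move: jN; rewrite leq_eqVlt ltnS => /orP[/eqP -> //|jN]; have /eqP -> : j == (a ^ 2)%N by rewrite eqn_leq jN.
  rewrite devE//.
  have jR : j%:R <= a%:R ^+ 2 + 1 :> R by rewrite -NR natr1 ler_nat.
  have j0 : 0 < j%:R :> R by rewrite ltr0n.
  rewrite ler_pdivlMr; last by have := c_ge0 p; lra.
  have e1 : 2 * b * (c p + j%:R) <= 2 * b * (2 * a%:R ^+ 2).
    by rewrite ler_pM2l ?mulr_gt0//; have := cp_le p; lra.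
  have e2 : 2 * b * (2 * a%:R ^+ 2) = 2 / 3 * (k%:R * u * a%:R).
    by rewrite bE; field; rewrite gt_eqF.
  have e3 : u * (2 * k%:R * a%:R) <= sd p * \sum_(h < j) z h p.
    apply: le_trans (_ : sd p * (2 * k%:R * a%:R) <= _).
      by apply: ler_wpM2r => //; rewrite !mulr_ge0// ltW.
    by rewrite ler_pM2l.
  have := prior_le p.
  have : 0 < u * a%:R by rewrite mulr_gt0.
  have : u * a%:R <= k%:R * u * a%:R by rewrite ler_pM2r.
  have : u * (2 * k%:R * a%:R) = 2 * (k%:R * u * a%:R) by ring.
  by lra.
- move=> p j jN; have [h1 h2 h3 h4] := ha p.
  have j0' : (0 < j)%N by exact: leq_trans jN.
  have j0 : 0 < j%:R :> R by rewrite ltr0n.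
  rewrite devE// ler_pdivlMr; last by have := c_ge0 p; lra.
  have ja : a%:R <= j%:R / a%:R :> R.
    by rewrite ler_pdivlMr// -expr2 -NR ler_nat.
  have e1 : b * j%:R = 2 * (k%:R * u / 12 * (j%:R / a%:R)).
    by rewrite bE; field; rewrite gt_eqF.
  have e2 : 0 <= b * c p by rewrite mulr_ge0// ltW.
  have e3 : u * a%:R / 12 <= k%:R * u / 12 * (j%:R / a%:R).
    have := ler_wpM2l (ltW u_gt0) ja; set q := j%:R / _ => hq.
    have q0 : 0 <= q by rewrite divr_ge0// ltW.
    have : u * q <= k%:R * u * q by rewrite ler_wpM2r.
    by lra.
  have e4 : - (k%:R * u / 12 * (j%:R / a%:R)) <= sd p * \sum_(h < j) z h p.
    have U0 : 0 < U by apply: lt_le_trans (U_ge p).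
    have -> : k%:R * u / 12 * (j%:R / a%:R) = U * (k%:R / (12 * U / u) * (j%:R / a%:R)).
      by field; rewrite !gt_eqF.
    apply: le_trans (_ : sd p * - (k%:R / (12 * U / u) * (j%:R / a%:R)) <= _).
      rewrite mulrN lerN2; apply: ler_wpM2r => //.
      by rewrite mulr_ge0// ?divr_ge0// ?mulr_ge0// ltW// mulr_gt0.
    by rewrite ler_pM2l// h4.
  by have := prior_le p; lra.
- move=> p p' j j' jN jN'.
  have Vle x i : (a ^ 2 <= i)%N -> V x i <= U ^+ 2 / a%:R ^+ 2.
    move=> iN; apply: le_trans (post_var_le _ _ _) _ => //; first exact: leq_trans iN.
    apply: ler_pM; rewrite ?sqr_ge0 ?invr_ge0//.
      by rewrite ler_sqr ?nnegrE ?U_ge// ltW// (lt_le_trans (sd_gt0 x)).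
    by rewrite lef_pV2 ?posrE ?exprn_gt0// -?NR ?ler_nat// ltr0n (leq_trans _ iN).
  apply: le_trans (LL' _ _) _; first by rewrite addr_ge0 ?post_var_ge0.
  apply: (@le_trans _ _ (L' * (2 * (U ^+ 2 / a%:R ^+ 2)))).
    by rewrite ler_pM2l//; have := Vle p j jN; have := Vle p' j' jN'; lra.
  have -> : L' * (2 * (U ^+ 2 / a%:R ^+ 2)) = 72 * L' * U ^+ 2 / (36 * a%:R ^+ 2).
    by field; rewrite gt_eqF.
  have -> : b ^+ 2 = k%:R ^+ 2 * u ^+ 2 / (36 * a%:R ^+ 2).
    by rewrite bE; field; rewrite gt_eqF.
  by rewrite ler_pM2r// invr_gt0 mulr_gt0 ?exprn_gt0.
move=> p; have [h1 h2 h3 h4] := ha p.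
set N := (a ^ 2)%N in N_gt0 NR *.
have N0' : 0 < N%:R :> R by rewrite ltr0n.
have X0 : 0 < c p + N%:R by have := c_ge0 p; lra.
have -> : M p N - M p N.+1 = (M p N - ymean p) - (M p N.+1 - ymean p) by ring.
rewrite [X in _ < X]mulrBr !devE// big_ord_recr /= [sd p * (_ + _)]mulrDr.
set A := sgn p * _ + sd p * \sum_(h < N) _.
have A0 : 0 <= A.
  have e3 : u * (2 * k%:R * a%:R) <= sd p * \sum_(h < N) z h p.
    apply: le_trans (_ : sd p * (2 * k%:R * a%:R) <= _).
      by apply: ler_wpM2r => //; rewrite !mulr_ge0// ltW.
    by rewrite ler_pM2l.
  have := prior_le p.
  have : u * a%:R <= k%:R * u * a%:R by rewrite ler_pM2r.
  have : u * (2 * k%:R * a%:R) = 2 * (k%:R * u * a%:R) by ring.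
  have : 0 < u * a%:R by rewrite mulr_gt0.
  by rewrite /A; lra.
rewrite addrA -/A -natr1 /V !post_varE//.
rewrite -/(c p) -[N.+2%:R]natr1 -natr1.
set X := c p + N%:R in X0 *.
have XE1 : c p + (N%:R + 1) = X + 1 by rewrite /X; ring.
have XE2 : c p + (N%:R + 1 + 1) = X + 2 by rewrite /X; ring.
rewrite XE1 XE2.
have XL : 2 * L' * sd p <= X.
  have h5 : 2 * L' * sd p <= 2 * L' * U by rewrite ler_pM2l ?U_ge// mulr_gt0.
  have h6 := ler_norm (2 * L' * U).
  have hC : 0 <= C.
    by apply: le_trans (Cterm p); rewrite addr_ge0// mulr_ge0// divr_ge0// ltW.
  have h7 : a%:R <= N%:R :> R by rewrite NR; lra.
  by have := c_ge0 p; rewrite /X; lra.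
have dV : 0 <= sd p ^+ 2 / X - sd p ^+ 2 / (X + 2).
  by rewrite -mulrBr mulr_ge0 ?sqr_ge0// subr_ge0 lef_pV2 ?posrE ?lerDl// addr_gt0.
by apply: le_lt_trans (LL' _ dV) _; exact: post_step_lt.
Qed.

End FavourablePosterior.

(** * From the sampling procedure to the abstract trajectory *)

Lemma mem_top (k m : nat) (s : 'S_k) (x : 'I_k) : (x \in top m s) = (s^-1%g x < m)%N.
Proof.
apply/imsetP/idP => [[i]|h]; first by rewrite inE => im ->; rewrite permK.
by exists (s^-1%g x); rewrite ?inE// permKV.
Qed.

Lemma card_top (k m : nat) (s : 'S_k) : (m <= k)%N -> #|top m s| = m.
Proof.
move=> mk; rewrite card_imset; last exact: perm_inj.
have winj : injective (widen_ord mk) by move=> x y /(congr1 val) /= /val_inj.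
rewrite -[RHS]card_ord -(card_imset _ winj).
apply: eq_card => i; rewrite !inE; apply/idP/imsetP => [im|[j _ ->] //=].
by exists (Ordinal im) => //; apply: val_inj.
Qed.

Lemma card_exchange (T : finType) (A B : {set T}) x : #|A| = #|B| ->
  x \in A -> x \notin B -> exists2 o, o \in B & o \notin A.
Proof.
move=> AB xA xB; have : ~~ (B \subset A).
  by apply: contraNN xB => BA; have /eqP -> : B == A by rewrite eqEcard BA AB leqnn.
by case/subsetPn => o; exists o.
Qed.

Lemma count_allocS (k q : nat) (a : nat -> design_context k q) t p :
  count_alloc a t.+1 p = (count_alloc a t p + (a t == p))%N.
Proof.
have E n : count_alloc a n p = (\sum_(s < n) (a s == p))%N.
  rewrite /count_alloc -sum1_card big_mkcond; apply: eq_bigr => s _.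
  by rewrite inE; case: eqP.
by rewrite !E big_ord_recr.
Qed.

Lemma Vhat_rule (R : realType) (k q m : nat) (sd : design_context k q -> R)
    (psd : design_context k q -> \bar R) (mu : design_context k q -> R)
    (n : design_context k q -> nat) (rk : 'I_q -> 'S_k) (hr h : design_context k q) :
  let term x P Q := (mu P - mu Q) ^+ 2 /
    (lookahead_var sd psd n x P + lookahead_var sd psd n x Q) in
  let act P Q := [&& P.2 == Q.2, P.1 \in top m (rk P.2) & Q.1 \notin top m (rk Q.2)] in
  (0 < m)%N -> (m < k)%N ->
  (Vhat m sd psd mu n rk hr <= Vhat m sd psd mu n rk h)%E ->
  exists P Q, act P Q /\ forall P' Q', act P' Q' -> term hr P Q <= term h P' Q'.
Proof.
move=> term act m0 mk le.
have Vle P Q : act P Q -> (Vhat m sd psd mu n rk h <= (term h P Q)%:E)%E.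
  case: P Q => [i l] [j l'] /and3P[/= /eqP <-]; rewrite !mem_top -leqNgt => im jm.
  apply: (@bigmin_inf _ _ _ _ l) => //; apply: (@bigmin_inf _ _ _ _ ((rk l)^-1%g i)) => //.
  by apply: (@bigmin_inf _ _ _ _ ((rk l)^-1%g j)) => //; rewrite !permKV.
apply: contrapT => no.
have lt P Q : act P Q -> (Vhat m sd psd mu n rk h < (term hr P Q)%:E)%E.
  move=> aPQ; rewrite ltNge; apply/negP => tl; apply: no; exists P, Q; split=> // P' Q' a'.
  by rewrite -lee_fin (le_trans tl) ?Vle.
have k0 : (0 < k)%N by apply: ltn_trans mk.
(* The designs in positions [0] and [m] form a term, so the minimum is not the neutral value [+oo];
   the strict comparison of the minima needs this. *)
have a0 : act (rk hr.2 (Ordinal k0), hr.2) (rk hr.2 (Ordinal mk), hr.2).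
  by rewrite /act /= eqxx !mem_top !permK /= m0 ltnn.
have fin : (Vhat m sd psd mu n rk h < +oo)%E by apply: lt_le_trans (lt _ _ a0) (leey _).
move: le; rewrite leNgt => /negP; apply.
apply/bigmin_gtP; split=> // l _; apply/bigmin_gtP; split=> // i im.
apply/bigmin_gtP; split=> // j mj; apply: lt.
by rewrite /act /= eqxx !mem_top !permK im -leqNgt.
Qed.

Lemma count_dichotomy (n : nat -> nat) : {homo n : s t / (s <= t)%N} ->
  exists o : option nat, if o is Some j then \forall t \near \oo, n t = j
    else n t @[t --> \oo] --> \oo.
Proof.
move=> mono; have [[B hB]|unb] := pselect (exists B, forall t, (n t <= B)%N).
  have ex : exists j, `[< exists t, n t = j >] by exists (n 0%N); apply/asboolP; exists 0%N.
  have ub j : `[< exists t, n t = j >] -> (j <= B)%N by move=> /asboolP[t <-].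
  case: (ex_maxnP ex ub) => j /asboolP[t0 nt0] jmax; exists (Some j).
  exists t0 => // t /= tt; apply/eqP; rewrite eqn_leq -{2}nt0 mono// andbT.
  by apply: jmax; apply/asboolP; exists t.
exists None => A [N _ NA]; have [t Nt] : exists t, (N <= n t)%N.
  apply: contrapT => no; apply: unb; exists N => t; rewrite leqNgt; apply/negP => lt.
  by apply: no; exists t; exact: ltnW.
by exists t => // t' /= tt'; apply: NA => /=; apply: leq_trans Nt _; exact: mono.
Qed.

(** A slope with [sd / (m + 1) <= e / 2] leaves a constant remainder, which large [n] absorbs
    together with the prior. *)
Lemma post_mean_cvg (R : realType) (sd pmean ym : R) (psd : \bar R) (y : nat -> R) :
  0 < sd -> (0 < psd)%E ->
  (exists x : R, forall m n : nat,
     `|\sum_(h < n) (y h - ym) / sd| <= n%:R / m.+1%:R + x * m.+1%:R ^+ 2) ->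
  post_mean sd pmean psd y n @[n --> \oo] --> ym.
Proof.
move=> sd0 psd0 [x hx]; apply/cvgrPdist_le => e e0.
pose m := Num.truncn (2 * sd / e); have hm : 2 * sd / e < m.+1%:R by exact: truncnS_gt.
set c := prior_precision psd * sd ^+ 2; have c0 : 0 <= c by exact: prior_weight_ge0.
pose K := `|c * (pmean - ym)| + sd * `|x * m.+1%:R ^+ 2|.
pose N := Num.truncn (2 * K / e); have hN : 2 * K / e < N.+1%:R by exact: truncnS_gt.
exists N.+1 => // n /= Nn; have n0 : (0 < n)%N by lia.
have nR : 0 < n%:R :> R by rewrite ltr0n.
have NR : N.+1%:R <= n%:R :> R by rewrite ler_nat.
rewrite distrC post_mean_dev//= -/c normrM normfV ler_pdivrMr; last first.
  by rewrite normr_gt0 gt_eqF//; lra.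
rewrite (ger0_norm (_ : 0 <= c + n%:R)); last by lra.
apply: le_trans (ler_normD _ _) _; rewrite [X in _ + X <= _]normrM (gtr0_norm sd0).
have h1 : sd * `|\sum_(h < n) (y h - ym) / sd| <= sd * (n%:R / m.+1%:R) + sd * `|x * m.+1%:R ^+ 2|.
  rewrite -mulrDr ler_pM2l//; apply: le_trans (hx m n) _; rewrite lerD2l; exact: ler_norm.
have h2 : sd * (n%:R / m.+1%:R) <= e / 2 * n%:R.
  rewrite mulrA ler_pdivrMr ?ltr0n// mulrAC; apply: ler_wpM2r => //.
  by move: hm; rewrite ltr_pdivrMr// => hm; lra.
have h3 : K <= e / 2 * n%:R.
  move: hN; rewrite ltr_pdivrMr// => hN.
  have : e * N.+1%:R <= e * n%:R by rewrite ler_pM2l.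
  by lra.
have h4 : 0 <= e * c by rewrite mulr_ge0// ltW.
apply: le_trans (lerD (lexx _) h1) _; rewrite addrCA.
apply: le_trans (lerD h2 h3) _; lra.
Qed.

Lemma standardized_mgf (R : realType) (d : measure_display) (Omega : measurableType d)
    (P : probability Omega R) (Y : {RV P >-> R}) (m s e l : R) :
  0 < s -> e ^+ 2 = 1 ->
  (forall B, measurable B -> distribution P Y B = normal_prob m s B) ->
  (\int[P]_w (expR (l * (e * ((Y w - m) / s))))%:E = (expR (l ^+ 2 / 2))%:E)%E.
Proof.
move=> s0 e1 hY; have := @normal_mgf R m s (l * e); rewrite gt_eqF// => /(_ isT).
rewrite exprMn e1 mulr1 => <-.
pose f (x : R) := (expR (l * e * ((x - m) / s)))%:E.
have mf : measurable_fun [set: R] f.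
  apply/measurable_EFinP/measurableT_comp => //; apply: measurable_funM => //.
  by apply: measurable_funM => //; exact: measurable_funD.
have f0 x : (0 <= f x)%E by rewrite lee_fin expR_ge0.
transitivity (\int[distribution P Y]_x f x)%E.
  rewrite ge0_integral_distribution//.
  by apply: eq_integral => w _ /=; rewrite /f mulrA.
(* [normal_prob] lives on a copy of [R] with another display. *)
pose T := g_sigma_algebraType (R.-ocitv.-measurable).
pose phi : T -> R := id.
have mphi : measurable_fun setT phi by move=> _ B mB; rewrite setTI.
pose phiM := isMeasurableFun.Build _ _ _ _ _ mphi.
pose phi' : {mfun T >-> R} := HB.pack phi phiM.
transitivity (\int[pushforward (normal_prob m s) phi']_x f x)%E.
  by apply: eq_measure_integral => B mB _; exact: hY.
by rewrite ge0_integral_pushforward.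
Qed.

Lemma normal_atomless (R : realType) (d : measure_display) (Omega : measurableType d)
    (P : probability Omega R) (Y : {RV P >-> R}) (m s x : R) :
  (forall B, measurable B -> distribution P Y B = normal_prob m s B) ->
  P (Y @^-1` [set x]) = 0%E.
Proof.
move=> hY; have -> : P (Y @^-1` [set x]) = distribution P Y [set x] by [].
rewrite hY//; have /null_content_dominatesP := @normal_prob_dominates R m s.
by apply=> //; exact: lebesgue_measure_set1.
Qed.

Lemma post_var_cvg (R : realType) (sd : R) (psd : \bar R) : 0 < sd -> (0 < psd)%E ->
  post_var sd psd n @[n --> \oo] --> 0.
Proof.
move=> sd0 psd0; apply/cvgrPdist_le => e e0.
pose N := Num.truncn (sd ^+ 2 / e); have hN : sd ^+ 2 / e < N.+1%:R by exact: truncnS_gt.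
exists N.+1 => // n /= Nn; have n0 : (0 < n)%N by exact: leq_trans Nn.
have nR : 0 < n%:R :> R by rewrite ltr0n.
rewrite sub0r normrN ger0_norm ?post_var_ge0//.
apply: le_trans (post_var_le sd0 psd0 n0) _.
rewrite ler_pdivrMr// mulrC -ler_pdivrMr// ltW// (lt_le_trans hN)// ler_nat//.
Qed.

Lemma top_exchange (k m : nat) (s s' : 'S_k) (i : 'I_k) : (m <= k)%N ->
  i \in top m s -> i \notin top m s' -> exists2 j, j \in top m s' & j \notin top m s.
Proof. by move=> mk; apply: card_exchange; rewrite !card_top. Qed.

Theorem theorem1 (R : realType) (k q m n0 : nat)
    (hm1 : (1 <= m)%N) (hmk : (m < k)%N) (hn0 : (1 <= n0)%N)
    (ymean : design_context k q -> R) (sd : design_context k q -> R)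
    (hsd : forall p, 0 < sd p)
    (pmean : design_context k q -> R) (psd : design_context k q -> \bar R)
    (hpsd : forall p, (0 < psd p)%E)
    (rho : 'I_q -> 'S_k)
    (hrho : forall l, ranks (fun i => ymean (i, l)) (rho l))
    (hgap : forall l (i j : 'I_k), (i < m)%N -> (m <= j)%N ->
       ymean (rho l j, l) < ymean (rho l i, l))
    (d d' : measure_display)
    (Omega : measurableType d) (T : measurableType d')
    (P : probability Omega R)
    (Y : nat -> design_context k q -> {RV P >-> R})
    (U : {RV P >-> T})
    (hY : forall h p (B : set R), measurable B ->
       distribution P (Y h p) B = normal_prob (ymean p) (sd p) B)
    (hind : independent_with (fun hp : nat * design_context k q => Y hp.1 hp.2) U)
    (A : nat -> Omega -> design_context k q)
    (rk : nat -> 'I_q -> Omega -> 'S_k)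
    (hA : nonanticipating U (fun h p => Y h p) A)
    (hrun : forall w : Omega,
       AOAmc_run m n0 sd pmean psd (fun h p => Y h p w) (A^~ w)
         (fun t l => rk t l w)) :
  forall l : 'I_q,
    {ae P, forall w, \forall t \near \oo, top m (rk t l w) = top m (rho l)}.

Proof.
pose D := design_context k q; pose I : choiceType := (nat * D)%type.
pose X : I -> {RV P >-> R} := fun hp => Y hp.1 hp.2.
have indepX : independent X.
  move=> s B us mB; have := hind s B setT us mB measurableT.
  rewrite preimage_setT setTI => ->.
  by rewrite [X in (X * _)%E](_ : _ = 1%E) ?mul1e//; exact: probability_setT.
have hX i (B : set R) : measurable B ->
    distribution P (X i) B = normal_prob (ymean i.2) (sd i.2) B by exact: hY.
(* The signs [e] make the prescribed side of each pair the positive one; the two constant choices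
   give two-sided growth bounds. *)
pose Z (e : D -> R) (i : I) w := e i.2 * ((X i w - ymean i.2) / sd i.2).
have sigZ e i : sigma_fun X [set i] (Z e i).
  apply/sigma_funE; apply: measurable_funM => //; apply: measurable_funM => //.
  by apply: measurable_funB => //; apply/sigma_funE; exact: sigma_fun_var.
have mgfZ e i l : e i.2 ^+ 2 = 1 ->
    (\int[P]_w (expR (l * Z e i w))%:E = (expR (l ^+ 2 / 2))%:E)%E.
  by move=> e1; apply: standardized_mgf => // B mB; exact: hX.
have gen := @generic _ _ _ P D X indepX (fun i x => normal_atomless x (hX i))
  sd pmean ymean psd hsd hpsd.
have growth : {ae P, forall w, forall b : bool, forall p : D, exists x : nat, forall n0 n : nat,
    \sum_(h < n) Z (fun=> if b then 1 else -1) (nat_of_ord h, p) w <=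
      n%:R / n0.+1%:R + x%:R * n0.+1%:R ^+ 2}.
  apply: filter_forall => b; apply: filter_forall => p.
  apply: (walk_growth indepX (@sigZ _) _ (e := fun h => (h, p))); last by move=> x y [].
  by move=> i l; apply: mgfZ; case: b; rewrite ?sqrrN expr1n.
(* Uniform bounds of the standard deviations; the added 1 gives [u <= 1 <= S], so the ratio
   [12 S / u] is at least 1, as [favourable_times] demands. *)
pose u : R := (1 + \sum_p (sd p)^-1)^-1; pose S : R := 1 + \sum_p sd p.
have inv0 p : 0 <= (sd p)^-1 by rewrite invr_ge0 ltW.
have u0 : 0 < u by rewrite invr_gt0 ltr_pwDl ?sumr_ge0.
have uS : u <= 1 by rewrite invf_le1 ?lerDl ?sumr_ge0// ltr_pwDl ?sumr_ge0.
have S1 : 1 <= S by rewrite lerDl sumr_ge0// => p _; exact: ltW.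
have u_le p : u <= sd p.
  rewrite -[leRHS]invrK lef_pV2 ?posrE ?invr_gt0 ?ltr_pwDl ?sumr_ge0//.
  by rewrite (bigD1 p)//= addrCA lerDl addr_ge0 ?sumr_ge0.
have S_ge p : sd p <= S.
  by rewrite /S (bigD1 p)//= addrCA lerDl addr_ge0 ?sumr_ge0// => j _; exact: ltW.
have r1 : 1 <= 12 * S / u by rewrite ler_pdivlMr//; lra.
(* Integer levels [kk] and finitely many sets [B] leave a single null set. *)
have fav : {ae P, forall w, forall B : {set D}, exists k0 : R, forall kk : nat, k0 <= kk%:R ->
    forall N0 : nat, exists2 b : nat, (N0 <= b)%N & forall p : D,
    let z h p := Z (fun p => if p \in B then 1 else -1) (h, p) w in
   [/\ z (b ^ 2)%N p <= - 1,
       2 * kk%:R * b%:R <= \sum_(h < b ^ 2) z h p,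
       2 * kk%:R * b%:R <= \sum_(h < (b ^ 2).+1) z h p &
       forall n, (b ^ 2 <= n)%N ->
         - (kk%:R / (12 * S / u) * (n%:R / b%:R)) <= \sum_(h < n) z h p]}.
  apply: filter_forall => B.
  have mB i l : (\int[P]_w (expR (l * Z (fun p => if p \in B then 1 else -1) i w))%:E =
      (expR (l ^+ 2 / 2))%:E)%E.
    by apply: mgfZ; case: ifP; rewrite ?sqrrN expr1n.
  have [k0 hk0] := favourable_times indepX (@sigZ _) mB r1.
  have : {ae P, forall w, forall kk : nat, k0 <= kk%:R ->
    forall N0 : nat, exists2 b : nat, (N0 <= b)%N & forall p : D,
    let z h p := Z (fun p => if p \in B then 1 else -1) (h, p) w in
   [/\ z (b ^ 2)%N p <= - 1,
       2 * kk%:R * b%:R <= \sum_(h < b ^ 2) z h p,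
       2 * kk%:R * b%:R <= \sum_(h < (b ^ 2).+1) z h p &
       forall n, (b ^ 2 <= n)%N ->
         - (kk%:R / (12 * S / u) * (n%:R / b%:R)) <= \sum_(h < n) z h p]}.
    apply: ae_foralln => kk; have [le|nle] := boolP (k0 <= kk%:R); last exact: aeW.
    by apply: filterS (hk0 _ le) => w h _.
  by apply: filterS => w h; exists k0.
have main : {ae P, forall w, \forall t \near \oo, forall l, top m (rk t l w) = top m (rho l)}.
  apply: filterS3 gen growth fav => w [genM genT] growth fav.
  have [n_t0 run] := hrun w.
  set cnt := count_alloc (A^~ w) in n_t0 run.
  pose M (p : D) j := post_mean (sd p) (pmean p) (psd p) (fun h => Y h p w) j.
  pose V (p : D) j := post_var (sd p) (psd p) j.
  pose tp t : {set D} := [set p | p.1 \in top m (rk t p.2 w)]%SET.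
  pose B : {set D} := [set p | p.1 \in top m (rho p.2)]%SET.
  have mk := ltnW hmk.
  have cntS t p : cnt t.+1 p = (cnt t p + (A t w == p))%N by exact: count_allocS.
  have /choice[c hc] : forall p : D, exists o : option nat,
      if o is Some j then \forall t \near \oo, cnt t p = j
      else cnt t p @[t --> \oo] --> \oo.
    move=> p; apply: count_dichotomy => t t' /subnKC <-.
    by elim: (t' - t)%N => [|n IH]; rewrite ?addn0// addnS cntS (leq_trans IH)// leq_addr.
  have sel : \forall t \near \oo, tp t = B.
    apply: (@selection_cvg R D 'I_q (fun p => p.2) M V ymean (A^~ w) cnt tp (k * q * n0)
      _ _ _ _ genM genT cntS _ _ _ _ _ c).
    - by move=> p j; exact: post_var_gt0.
    - by move=> p i j; exact: post_var_lt.
    - by move=> p; exact: post_var_cvg.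
    - move=> p; apply: post_mean_cvg => //.
      have [x1 h1] := growth true p; have [x2 h2] := growth false p.
      exists (x1%:R + x2%:R) => n1 n2.
      have sq : 0 <= n1.+1%:R ^+ 2 :> R by exact: sqr_ge0.
      set s := \sum_(h < n2) _.
      have le1 : s <= n2%:R / n1.+1%:R + x1%:R * n1.+1%:R ^+ 2.
        by have := h1 n1 n2; rewrite /Z /= -mulr_sumr mul1r.
      have le2 : - s <= n2%:R / n1.+1%:R + x2%:R * n1.+1%:R ^+ 2.
        by have := h2 n1 n2; rewrite /Z /= -mulr_sumr mulN1r.
      have l1 : 0 <= x1%:R * n1.+1%:R ^+ 2 :> R by rewrite mulr_ge0.
      have l2 : 0 <= x2%:R * n1.+1%:R ^+ 2 :> R by rewrite mulr_ge0.
      rewrite mulrDl ler_norml lerNl (le_trans le2) ?(le_trans le1)//.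
        by rewrite lerD2l lerDl.
      by rewrite lerD2l lerDr.
    - by move=> p; rewrite n_t0.
    - move=> t [i l] [j l'] tt /and3P[/= /eqP e]; subst l'; rewrite !inE /= !mem_top -leqNgt => im jm.
      have [/(_ l) rkt _] := run t tt.
      by have := rkt _ _ (leq_trans (ltnW im) jm); rewrite !permKV.
    - move=> t t' [i l] _ _; rewrite !inE /= => it it'.
      by have [j jt' jt] := top_exchange mk it it'; exists (j, l); rewrite !inE.
    - move=> t [i l] _; have k0 : (0 < k)%N by exact: leq_ltn_trans hmk.
      have [it|it] := boolP (i \in top m (rk t l w)).
        exists (rk t l w (Ordinal hmk), l) => //.
        by rewrite !inE /= it !mem_top permK /= ltnn.
      exists (rk t l w (Ordinal k0), l) => //.
      by rewrite !inE /= (negbTE it) !mem_top permK /= hm1.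
    - move=> t hr tt; have [_ /(_ hr) rkt] := run t tt.
      have [P0 [Q0 [act0 le0]]] := Vhat_rule hm1 hmk rkt.
      have actE P1 Q1 : active (fun p : D => p.2) tp t P1 Q1 =
          [&& P1.2 == Q1.2, P1.1 \in top m (rk t P1.2 w) & Q1.1 \notin top m (rk t Q1.2 w)].
        by rewrite /active !inE.
      have termE x P1 Q1 : term M V cnt (Some x) t P1 Q1 = (M P1 (cnt t P1) - M Q1 (cnt t Q1)) ^+ 2 /
          (lookahead_var sd psd (cnt t) x P1 + lookahead_var sd psd (cnt t) x Q1).
        have E p : (Some x == Some p) = (p == x) by rewrite eq_sym.
        by rewrite /term /lookahead_var !E.
      exists P0, Q0; rewrite actE; split=> // P1 Q1; rewrite actE !termE.
      exact: le0.
    - by move=> p j e; have := hc p; rewrite e.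
    - by move=> p e; have := hc p; rewrite e.
    - move=> B0 L N0; have [k0 hk0] := fav B0.
      apply: (@favourable_posterior R D sd pmean ymean psd (fun h p => Y h p w) hsd hpsd u S k0
        (fun p => if p \in B0 then 1 else -1) u0 u_le S_ge) => //.
      by move=> p; case: ifP; rewrite ?sqrrN expr1n.
    - move=> [i l] [j l'] /= e; subst l'; rewrite !inE /= !mem_top -leqNgt => im jm.
      by have := hgap l _ _ im jm; rewrite !permKV.
    - move=> t [i l] _; rewrite !inE /= => it it'.
      by have [j jt' jt] := top_exchange mk it it'; exists (j, l); rewrite !inE.
    - move=> t [i l] _; rewrite !inE /= => it it'.
      by have [j jt' jt] := top_exchange mk it it'; exists (j, l); rewrite !inE.
  apply: filterS sel => t tB l; apply/setP => i.
  by have := congr1 (fun T0 : {set D} => (i, l) \in T0) tB; rewrite !inE.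
by move=> l; apply: filterS main => w; apply: filterS => t.
Qed.
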